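(* Let $N_H\ge3$ and $k\ge0$ be integers and let $(C_{n,h},E_{N_H,h},\Phi_{N_H,h})$ be a solution on $[0,\infty)$ of the semi-discrete discontinuous Galerkin/Hermite scheme for the Vlasov equation coupled with the mixed finite element approximation of the Poisson equation given in the context. Let $f_{N_H,N_x}(t,x,v)=\sum_{n=0}^{N_H-1}C_{n,h}(t,x)\Psi_n(t,v)$. Then: (1) Mass is conserved: $\frac{d}{dt}\int_0^LC_{0,h}\,dx=0$. (2) Assuming that $\|f_{N_H,N_x}(0)\|_{\omega(0)}<+\infty$, $$\|f_{N_H,N_x}(t)\|_{\omega(t)}\le\|f_{N_H,N_x}(0)\|_{\omega(0)}\,e^{t/(4\gamma)},\qquad\forall t\ge0.$$ (3) For every $T>0$ there exists a constant $C_T>0$ such that $\|E_{N_H,h}(t)\|_\infty\le C_T$ for all $t\in[0,T]$.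
   Context: Let $L>0$, $\alpha_0>0$, $\gamma>0$; all functions are real-valued. Let $0=x_{\frac12}<x_{\frac32}<\dots<x_{N_x+\frac12}=L$ be a partition of $[0,L]$ with cells $I_i=[x_{i-\frac12},x_{i+\frac12}]$, let $P_k(I)$ be the set of polynomials of degree at most $k$ on $I$, and $$V_h^k=\{u\in L^2(0,L):\ u|_{I_i}\in P_k(I_i)\ \forall i\},\qquad W_h^{k+1}=\{u\in C^0([0,L]):\ u(0)=u(L),\ u|_{I_i}\in P_{k+1}(I_i)\ \forall i\}.$$ Periodic boundary conditions are used (the points $0$ and $L$ are identified when taking one-sided limits). One-sided limits are $u^\pm_{i+\frac12}=\lim_{\Delta x\to0^\pm}u(x_{i+\frac12}+\Delta x)$. Hermite polynomials: $H_{-1}=0$, $H_0=1$, $\sqrt n\,H_n(\xi)=\xi H_{n-1}(\xi)-\sqrt{n-1}\,H_{n-2}(\xi)$ for $n\ge1$. Basis functions: $\Psi_n(t,v)=\alpha(t)\,H_n(\alpha(t)v)\,\frac{e^{-(\alpha(t)v)^2/2}}{\sqrt{2\pi}}$, with scaling function $$\alpha(t)=\alpha_0\left(1+\gamma\,\alpha_0^2\int_0^t\|E_{N_H,h}(s)\|_\infty^2\,ds\right)^{-1/2},$$ so $\alpha(0)=\alpha_0$ and $\alpha'=-\frac\gamma2\|E_{N_H,h}(t)\|_\infty^2\alpha^3$; $\|\cdot\|_\infty$ is the sup norm in $x$. Weight and norm: $\omega(t,v)=\sqrt{2\pi}\,e^{(\alpha(t)v)^2/2}$ and $\|u\|_{\omega(t)}^2=\int_0^L\int_{\mathbb{R}}|u(x,v)|^2\omega(t,v)\,dv\,dx$;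 equivalently $\|f_{N_H,N_x}(t)\|_{\omega(t)}^2=\sum_{n=0}^{N_H-1}\alpha(t)\int_0^LC_{n,h}^2(t,x)\,dx$. DG scheme for the Vlasov equation: $C_{n,h}(t,\cdot)\in V_h^k$, continuously differentiable in $t$, with the convention $C_{n,h}=0$ for $n<0$ and for $n\ge N_H$, such that for all $\varphi_n\in V_h^k$, all $j=1,\dots,N_x$ and $0\le n\le N_H-1$, $$\frac{d}{dt}\int_{I_j}C_{n,h}\varphi_n\,dx-\frac{\alpha'}{\alpha}\int_{I_j}\left(nC_{n,h}+\sqrt{(n-1)n}\,C_{n-2,h}\right)\varphi_n\,dx+a_n^j(g_n,\varphi_n)-\alpha\sqrt n\int_{I_j}E_{N_H,h}C_{n-1,h}\varphi_n\,dx=0,$$ where $$a_n^j(g_n,\varphi_n)=-\int_{I_j}g_n\varphi_n'\,dx+\hat g_{n,j+\frac12}\varphi^-_{n,j+\frac12}-\hat g_{n,j-\frac12}\varphi^+_{n,j-\frac12},\qquad g_n=\frac1\alpha\left(\sqrt{n+1}\,C_{n+1,h}+\sqrt n\,C_{n-1,h}\right),$$ with numerical flux $\hat g_n=\frac12\left[g_n^-+g_n^+-\delta_n(C_{n,h}^+-C_{n,h}^-)\right]$, $\delta_0=0$ and $\delta_n=\sqrt{N_H}/\alpha(t)$ for $1\le n\le N_H-1$. Mixed finite element approximation of the Poisson equation: $(E_{N_H,h}(t,\cdot),\Phi_{N_H,h}(t,\cdot))\in W_h^{k+1}\times V_h^k$ such that for all $(\eta,\zeta)\in W_h^{k+1}\times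 V_h^k$, $$\int_0^L\Phi_{N_H,h}\,\eta'\,dx=\int_0^LE_{N_H,h}\,\eta\,dx,\qquad\int_0^L\partial_xE_{N_H,h}\,\zeta\,dx=\int_0^L(C_{0,h}-\rho_0)\,\zeta\,dx,$$ where $\rho_0$ is the constant with $\int_0^L(C_{0,h}-\rho_0)\,dx=0$. *)

(* Defs.v *)
From HB Require Import structures.
From mathcomp Require Import all_boot all_order all_algebra.
From mathcomp Require Import all_classical all_reals all_analysis.

Set Implicit Arguments.
Unset Strict Implicit.
Unset Printing Implicit Defensive.

Import Order.TTheory GRing.Theory Num.Theory.
Import numFieldNormedType.Exports.

Local Open Scope classical_set_scope.
Local Open Scope ring_scope.

(* Calculus on the time interval [0, +oo[: the difference quotient is only
   taken inside [0, +oo[, so the derivative at 0 is the right derivative. *)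
Definition diff_quot_ge0 (R : realType) (f : R -> R) (t : R) :
    set_system R :=
  (s - t)^-1 * (f s - f t) @[s --> within [set s : R | 0 <= s] t^'].

Definition is_derive_ge0 (R : realType) (f : R -> R) (t l : R) : Prop :=
  diff_quot_ge0 f t --> l.

Definition derive_ge0 (R : realType) (f : R -> R) (t : R) : R :=
  lim (diff_quot_ge0 f t).

Definition C1_ge0 (R : realType) (f : R -> R) : Prop :=
  exists df : R -> R, (forall t : R, 0 <= t -> is_derive_ge0 f t (df t)) /\
    {within `[0, +oo[, continuous df}.

(* [node i], i = 0, ..., Nx, is the point x_{i+1/2}; cells are indexed from 0,
   so that cell [j < Nx] is I_{j+1}. *)
Definition is_partition (R : realType) (L : R) (Nx : nat) (node : nat -> R) :
    Prop :=
  [/\ node 0 = 0, node Nx = L &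
      forall i, (i < Nx)%N -> node i < node i.+1].

Definition cell (R : realType) (node : nat -> R) (j : nat) : set R :=
  `[node j, node j.+1].

(* Elements of V_h^k are L^2 classes, possibly discontinuous at the nodes: their
   representatives are constrained in the interior of the cells only, and their
   values at the nodes are arbitrary (everything below uses integrals and
   one-sided limits). *)
Definition Vh (R : realType) (Nx : nat) (node : nat -> R) (k : nat)
    (u : R -> R) : Prop :=
  forall j, (j < Nx)%N -> exists2 p : {poly R}, (size p <= k.+1)%N &
    forall x, node j < x < node j.+1 -> u x = p.[x].

(* [Wh L Nx node m] is W_h^m. *)
Definition Wh (R : realType) (L : R) (Nx : nat) (node : nat -> R) (m : nat)
    (u : R -> R) : Prop :=
  [/\ {within `[0, L], continuous u}, u 0 = u L &
      forall j, (j < Nx)%N -> exists2 p : {poly R}, (size p <= m.+1)%N &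
        forall x, cell node j x -> u x = p.[x]].

(* One-sided limits u^-_{i+1/2}, u^+_{i+1/2} at [node i], where 0 and L are
   identified: on the left of 0 one looks on the left of L, and conversely. *)
Definition traceL (R : realType) (Nx : nat) (node : nat -> R) (u : R -> R)
    (i : nat) : R :=
  lim (u x @[x --> (if i == 0%N then node Nx else node i)^'-]).

Definition traceR (R : realType) (Nx : nat) (node : nat -> R) (u : R -> R)
    (i : nat) : R :=
  lim (u x @[x --> (if i == Nx then node 0 else node i)^'+]).

Definition supnorm (R : realType) (L : R) (u : R -> R) : R :=
  sup [set `|u x| | x in `[0, L]].

(* The case n = 1 takes H_{-1} = 0 into account. *)
Fixpoint hermite (R : realType) (n : nat) (xi : R) : R :=
  match n with
  | 0 => 1
  | n'.+1 =>
    (Num.sqrt n'.+1%:R)^-1 *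
    (xi * hermite n' xi -
     (if n' is n''.+1 then Num.sqrt n'%:R * hermite n'' xi else 0))
  end.

Definition Psi (R : realType) (alpha : R -> R) (n : nat) (t v : R) : R :=
  alpha t * hermite n (alpha t * v) *
  (expR (- ((alpha t * v) ^+ 2 / 2)) / Num.sqrt (2 * pi)).

Definition scaling (R : realType) (L alpha0 gamma : R) (E : R -> R -> R)
    (t : R) : R :=
  alpha0 *
  (1 + gamma * alpha0 ^+ 2 *
     (\int[@lebesgue_measure R]_(s in `[0, t]) ((supnorm L (E s)) ^+ 2)))
  `^ (- 2^-1).

Definition weight (R : realType) (alpha : R -> R) (t v : R) : R :=
  Num.sqrt (2 * pi) * expR ((alpha t * v) ^+ 2 / 2).

Definition weighted_norm (R : realType) (L : R) (w : R -> R)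
    (u : R -> R -> R) : \bar R :=
  sqrte (\int[@lebesgue_measure R]_(x in `[0%R, L])
    (\int[@lebesgue_measure R]_v ((`|u x v| ^+ 2 * w v)%R)%:E))%E.

(* [lag C d n] is C_{n-d}, with C_m = 0 for m < 0. *)
Definition lag (R : realType) (C : nat -> R -> R -> R) (d n : nat) :
    R -> R -> R :=
  if (d <= n)%N then C (n - d)%N else fun _ _ => 0.

Definition gfun (R : realType) (alpha : R -> R) (C : nat -> R -> R -> R)
    (n : nat) (t x : R) : R :=
  (alpha t)^-1 *
  (Num.sqrt n.+1%:R * C n.+1 t x + Num.sqrt n%:R * lag C 1 n t x).

Definition delta (R : realType) (NH : nat) (alpha : R -> R) (n : nat) (t : R) :
    R :=
  if n == 0%N then 0 else Num.sqrt NH%:R / alpha t.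

Definition num_flux (R : realType) (Nx : nat) (node : nat -> R) (NH : nat)
    (alpha : R -> R) (C : nat -> R -> R -> R) (n : nat) (t : R) (i : nat) : R :=
  2^-1 * (traceL Nx node (gfun alpha C n t) i
          + traceR Nx node (gfun alpha C n t) i
          - delta NH alpha n t *
            (traceR Nx node (C n t) i - traceL Nx node (C n t) i)).

Definition aform (R : realType) (Nx : nat) (node : nat -> R) (NH : nat)
    (alpha : R -> R) (C : nat -> R -> R -> R) (n j : nat) (t : R)
    (phi : R -> R) : R :=
  - (\int[@lebesgue_measure R]_(x in cell node j)
      (gfun alpha C n t x * derive1 phi x))
  + num_flux Nx node NH alpha C n t j.+1 * traceL Nx node phi j.+1
  - num_flux Nx node NH alpha C n t j * traceR Nx node phi j.

Definition dg_vlasov (R : realType) (Nx : nat) (node : nat -> R) (NH k : nat)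
    (alpha : R -> R) (C : nat -> R -> R -> R) (E : R -> R -> R) : Prop :=
  forall (phi : R -> R) (j n : nat) (t : R),
    Vh Nx node k phi -> (j < Nx)%N -> (n < NH)%N -> 0 <= t ->
    derive_ge0 (fun s : R =>
        (\int[@lebesgue_measure R]_(x in cell node j) (C n s x * phi x))) t
    - derive_ge0 alpha t / alpha t *
      (\int[@lebesgue_measure R]_(x in cell node j)
        ((n%:R * C n t x + Num.sqrt (n.-1 * n)%:R * lag C 2 n t x) * phi x))
    + aform Nx node NH alpha C n j t phi
    - alpha t * Num.sqrt n%:R *
      (\int[@lebesgue_measure R]_(x in cell node j)
        (E t x * lag C 1 n t x * phi x)) = 0.

(* Mixed finite element approximation of -Phi'' = C0 - rho0 with E = - Phi', for
   a given density C0. When the density depends on time, rho0 is not required to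
   be constant in time: that would be assuming mass conservation. *)
Definition mixed_poisson (R : realType) (L : R) (Nx : nat) (node : nat -> R)
    (k : nat) (C0 E Phi : R -> R) : Prop :=
  exists2 rho0 : R,
    (\int[@lebesgue_measure R]_(x in `[0, L]) (C0 x - rho0)) = 0 &
    forall eta zeta : R -> R, Wh L Nx node k.+1 eta -> Vh Nx node k zeta ->
      (\int[@lebesgue_measure R]_(x in `[0, L]) (Phi x * derive1 eta x))
      = (\int[@lebesgue_measure R]_(x in `[0, L]) (E x * eta x))
      /\
      (\int[@lebesgue_measure R]_(x in `[0, L]) (derive1 E x * zeta x))
      = (\int[@lebesgue_measure R]_(x in `[0, L]) ((C0 x - rho0) * zeta x)).

(* A function valued in the finite-dimensional space V_h^k is C^1 in time iff
   its values at each point interior to a cell are. *)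
Record dg_hermite_solution (R : realType) (L alpha0 gamma : R) (Nx : nat)
    (node : nat -> R) (NH k : nat) (C : nat -> R -> R -> R)
    (E Phi : R -> R -> R) : Prop := {
  sol_C_Vh : forall n t, 0 <= t -> Vh Nx node k (C n t);
  sol_C_C1 : forall n j x, (j < Nx)%N -> node j < x < node j.+1 ->
    C1_ge0 (fun t => C n t x);
  sol_C_trunc : forall n t x, (NH <= n)%N -> 0 <= t -> C n t x = 0;
  sol_E_Wh : forall t, 0 <= t -> Wh L Nx node k.+1 (E t);
  sol_Phi_Vh : forall t, 0 <= t -> Vh Nx node k (Phi t);
  sol_vlasov : dg_vlasov Nx node NH k (scaling L alpha0 gamma E) C E;
  sol_poisson : forall t, 0 <= t ->
    mixed_poisson L Nx node k (C 0%N t) (E t) (Phi t)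
}.

Definition f_approx (R : realType) (NH : nat) (alpha : R -> R)
    (C : nat -> R -> R -> R) (t x v : R) : R :=
  \sum_(n < NH) C n t x * Psi alpha n t v.

(* Main.v *)
(* On each cell C_n is the Lagrange interpolant of its values at k + 1 interior
   points, so everything depends on time through finitely many C^1 functions. The
   mixed Poisson problem says that E' = C_0 - rho_0 on each cell and that E has
   mean zero; hence sup |E(t) - E(s)| is controlled by the variation of these
   values, |E(t)|_oo is continuous in t, which gives (3), and alpha is
   differentiable with alpha' = - gamma/2 |E|_oo^2 alpha^3.
   Testing the equation for C_0 with 1, the fluxes telescope, which gives (1).
   For (2), the Hermite functions being orthonormal, the squared norm is
   alpha * sum_n \int C_n^2. Test the n-th equation with C_n and sum: the volume
   and centered flux terms cancel by antisymmetry, the jump penalization has a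
   sign, and the field term sum_n sqrt n E C_(n-1) C_n is absorbed by the square
   terms produced by alpha' at the cost of 1/(2 gamma) times the squared norm.
   Gronwall's lemma concludes. *)
Require Import Defs.
From HB Require Import structures.
From mathcomp Require Import all_boot all_order all_algebra.
From mathcomp Require Import all_classical all_reals all_analysis.
From mathcomp Require Import measurable_realfun qpoly ring lra.

Set Implicit Arguments.
Unset Strict Implicit.
Unset Printing Implicit Defensive.

Import Order.TTheory GRing.Theory Num.Theory.
Import numFieldNormedType.Exports.

Local Open Scope classical_set_scope.
Local Open Scope ring_scope.

(** * Integrals of polynomials on an interval *)

(** Membership in [Vh] fixes a function only inside the cells, and the scheme sees it through
    Lebesgue integrals, [derive1] and one-sided limits. Each such function is traded, cell by cell,
    for a polynomial: integrals become the linear functional [pint], traces become evaluations,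
    derivatives become formal.

    The key inequality is pointwise in x. The field contributes b = alpha^2 E(x), while alpha'
    supplies squares with weight a = gamma/2 |E|_oo^2 alpha^3. Absorbing the former with the help of
    d * sum c_n^2 asks for b^2 <= 4 a d, and d = alpha/(2 gamma) makes 4 a d exactly alpha^4
    |E|_oo^2. Taking the square root of the energy turns 1/(2 gamma) into 1/(4 gamma).

    Differentiating [scaling] requires continuity in time of the sup norm of the field. This is
    obtained from the Poisson problem and the regularity of C_0 alone, without the Vlasov equation,
    so that no circularity arises with alpha. Derivatives at time 0 being one-sided, the growth
    argument uses two-sided derivatives for t > 0 and only continuity at 0. *)

Definition pint (R : realType) (a b : R) (p : {poly R}) : R :=
  \int[@lebesgue_measure R]_(x in `[a, b]) p.[x].

Lemma continuous_integrable_itv (R : realType) (a b : R) (f : R -> R) :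
  {within `[a, b], continuous f} ->
  (@lebesgue_measure R).-integrable `[a, b] (EFin \o f).
Proof.
by move=> cf; apply: continuous_compact_integrable => //; exact: segment_compact.
Qed.

Lemma integrable_horner (R : realType) (a b : R) (p : {poly R}) :
  (@lebesgue_measure R).-integrable `[a, b] (EFin \o horner p).
Proof.
apply: continuous_integrable_itv; apply: continuous_subspaceT.
exact: continuous_horner.
Qed.

Lemma measurable_horner_itvoo (R : realType) (a b : R) (u : R -> R)
    (p : {poly R}) :
  (forall x, a < x < b -> u x = p.[x]) ->
  measurable_fun `]a, b[ u.
Proof.
move=> up; apply: (@eq_measurable_fun _ _ _ _ _ (horner p)).
  by move=> x /[!inE]/=; rewrite in_itv/= => /up.
exact: measurable_poly.
Qed.

Lemma integrable_eq_horner (R : realType) (a b : R) (u : R -> R)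
    (p : {poly R}) :
  (forall x, a < x < b -> u x = p.[x]) ->
  (@lebesgue_measure R).-integrable `[a, b] (EFin \o u).
Proof.
move=> up; apply/integrableP; split.
  apply/measurable_EFinP; apply: (@measurable_fun_itv_cc _ _ _ false true).
  exact: measurable_horner_itvoo up.
have /integrableP[_] := integrable_horner a b p.
rewrite (_ : (\int[_]_(x in _) _)%E = (\int[lebesgue_measure]_(x in `[a, b])
   (`|(EFin \o u) x|)%E)%E)//.
apply: (@eq_integral_itv_bounded _ _ _ (fun x => `|u x|) (fun x => `|p.[x]|)).
- apply: measurableT_comp => //.
  exact: measurable_horner_itvoo (fun x _ => erefl p.[x]).
- by apply: measurableT_comp => //; exact: measurable_horner_itvoo up.
- by move=> x; rewrite in_itv/= => /up ->.
Qed.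

(** Agreement is assumed on the open interval only, since elements of [Vh] are arbitrary at the
    nodes; the endpoints form a null set. *)
Lemma Rintegral_eq_horner (R : realType) (a b : R) (u : R -> R)
    (p : {poly R}) :
  (forall x, a < x < b -> u x = p.[x]) ->
  \int[@lebesgue_measure R]_(x in `[a, b]) u x = pint a b p.
Proof.
move=> up; congr fine; apply: eq_integral_itv_bounded.
- exact: measurable_horner_itvoo up.
- exact: measurable_horner_itvoo (fun x _ => erefl p.[x]).
- by move=> x; rewrite in_itv/= => /up ->.
Qed.

Lemma pintD (R : realType) (a b : R) (p q : {poly R}) :
  pint a b (p + q) = pint a b p + pint a b q.
Proof.
rewrite /pint -RintegralD//; try exact: integrable_horner.
by apply: eq_Rintegral => x _; rewrite hornerD.
Qed.

Lemma pintZ (R : realType) (a b c : R) (p : {poly R}) :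
  pint a b (c *: p) = c * pint a b p.
Proof.
rewrite /pint -RintegralZl//; last exact: integrable_horner.
by apply: eq_Rintegral => x _; rewrite hornerZ.
Qed.

Lemma pint0 (R : realType) (a b : R) : pint a b 0 = 0.
Proof. by rewrite -(scale0r 0) pintZ mul0r. Qed.

Lemma pintN (R : realType) (a b : R) (p : {poly R}) :
  pint a b (- p) = - pint a b p.
Proof. by rewrite -scaleN1r pintZ mulN1r. Qed.

Lemma pintB (R : realType) (a b : R) (p q : {poly R}) :
  pint a b (p - q) = pint a b p - pint a b q.
Proof. by rewrite pintD pintN. Qed.

Lemma pint_sum (R : realType) (a b : R) (I : Type) (r : seq I) (P : pred I)
    (F : I -> {poly R}) :
  pint a b (\sum_(i <- r | P i) F i) = \sum_(i <- r | P i) pint a b (F i).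
Proof. exact: (big_morph (pint a b) (@pintD R a b) (pint0 a b)). Qed.

Lemma pint_deriv (R : realType) (a b : R) (p : {poly R}) : a < b ->
  pint a b p^`() = p.[b] - p.[a].
Proof.
move=> ab; rewrite /pint /Rintegral (@continuous_FTC2 _ _ (horner p))//.
- by apply: continuous_subspaceT; exact: continuous_horner.
- split; first by move=> x _; exact: derivable_horner.
  + by apply: cvg_at_right_filter; exact: continuous_horner.
  + by apply: cvg_at_left_filter; exact: continuous_horner.
- by move=> x _; rewrite derivE.
Qed.

Lemma pintC (R : realType) (a b c : R) : a < b -> pint a b c%:P = c * (b - a).
Proof.
move=> ab; have -> : c%:P = (c *: 'X)^`() by rewrite derivZ derivX alg_polyC.
by rewrite pint_deriv// !hornerE mulrBr.
Qed.

Lemma le_pint (R : realType) (a b : R) (p q : {poly R}) :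
  (forall x, a <= x <= b -> p.[x] <= q.[x]) -> pint a b p <= pint a b q.
Proof.
by move=> pq; apply: le_Rintegral => //; exact: integrable_horner.
Qed.

Lemma pint_ge0 (R : realType) (a b : R) (p : {poly R}) :
  (forall x, a <= x <= b -> 0 <= p.[x]) -> 0 <= pint a b p.
Proof. by move=> p0; rewrite -(pint0 a b) le_pint// => x /p0; rewrite horner0. Qed.

Lemma horner_bounded_itv (R : realType) (a b : R) (p : {poly R}) :
  exists2 B, 0 <= B & forall x, a <= x <= b -> `|p.[x]| <= B.
Proof.
have [ab|ba] := leP a b; last first.
  by exists 0 => // x /andP[ax xb]; move: (le_trans ax xb); rewrite leNgt ba.
have cp : {within `[a, b], continuous (fun x => `|p.[x]|)}.
  apply: continuous_subspaceT => x; apply: cvg_norm; exact: continuous_horner.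
have [c _ cP] := EVT_max ab cp.
by exists `|p.[c]| => // x xab; apply: cP; rewrite in_itv.
Qed.

(** An infinite sequence of distinct interior points, serving every degree at once; the shift by two
    keeps the point of index 0 away from [b]. *)
Definition interp_node (R : realType) (a b : R) (m : nat) : R :=
  a + (b - a) / m.+2%:R.

Lemma interp_node_itv (R : realType) (a b : R) (m : nat) : a < b ->
  a < interp_node a b m < b.
Proof.
move=> ab; have m2 : 0 < m.+2%:R :> R by [].
rewrite ltrDl divr_gt0 ?subr_gt0//= -ltrBrDl ltr_pdivrMr//.
by rewrite ltr_pMr ?subr_gt0// ltr1n.
Qed.

Lemma interp_node_inj (R : realType) (a b : R) : a < b ->
  injective (interp_node a b).
Proof.
move=> ab m m' /addrI /mulfI; rewrite subr_eq0 gt_eqF// => /(_ isT) /invr_inj.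
by move/eqP; rewrite eqr_nat => /eqP[].
Qed.

Lemma poly_eq0_itv (R : realType) (a b : R) (p : {poly R}) : a < b ->
  (forall x, a < x < b -> p.[x] = 0) -> p = 0.
Proof.
move=> ab p0; apply/eqP/negPn/negP => p_neq0.
have := @max_poly_roots _ p (map (interp_node a b) (iota 0 (size p))) p_neq0.
rewrite size_map size_iota ltnn map_inj_uniq ?iota_uniq; last exact: interp_node_inj.
move=> roots; suff : false by []; apply: roots => //.
by apply/allP => x /mapP[m _ ->]; rewrite /root p0 ?interp_node_itv.
Qed.

(** A primitive of [p ^+ 2] is nondecreasing and takes the same value at both ends, so it is
    constant on the interval, hence constant as a polynomial, and its derivative vanishes. *)
Lemma pint_sqr_eq0 (R : realType) (a b : R) (p : {poly R}) : a < b ->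
  pint a b (p ^+ 2) = 0 -> p = 0.
Proof.
move=> ab ip0; apply: (poly_eq0_itv ab) => x /andP[ax xb].
have pge0 y : 0 <= (p ^+ 2).[y] by rewrite horner_exp sqr_ge0.
have [F FE] : exists F : {poly R}, F^`() = p ^+ 2.
  pose s := p ^+ 2.
  (* The coefficient of index 0 divides by zero, which is harmless: it is lost in the derivative. *)
  exists (\poly_(i < (size s).+1) (s`_i.-1 / i%:R)).
  apply/polyP => i; rewrite coef_deriv coef_poly ltnS /=.
  case: ltnP => si; last by rewrite mul0rn nth_default.
  by rewrite -[LHS]mulr_natr divfK// pnatr_eq0.
have F_homo y z : y <= z -> F.[y] <= F.[z].
  rewrite le_eqVlt => /predU1P[->//|yz]; rewrite -subr_ge0 -pint_deriv// FE.
  by apply: pint_ge0 => w _.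
have FaFb : F.[a] = F.[b].
  by apply/eqP; rewrite eq_sym -subr_eq0 -pint_deriv// FE ip0.
have F_cst : F - F.[a]%:P = 0.
  apply: (poly_eq0_itv ab) => y /andP[ay yb]; rewrite !hornerE.
  apply/eqP; rewrite subr_eq0 eq_le (F_homo a) ?(ltW ay)// andbT.
  by rewrite FaFb F_homo// ltW.
have : (F - F.[a]%:P)^`() = 0 by rewrite F_cst deriv0.
rewrite derivB derivC subr0 FE => /eqP; rewrite expf_eq0/= => /eqP ->.
by rewrite horner0.
Qed.

(** * Algebra of the moment system and of the fluxes *)

(** Completing the square needs [a > 0]; the degenerate case occurs whenever the field vanishes, and
    there the discriminant condition forces [b = 0]. *)
Lemma quadratic_form_ge0 (R : realFieldType) (a b d x y : R) :
  0 <= a -> 0 <= d -> b ^+ 2 <= 4 * a * d ->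
  0 <= a * x ^+ 2 - b * y * x + d * y ^+ 2.
Proof.
rewrite le_eqVlt => /predU1P[<- d0|a_gt0 d0 disc].
  rewrite mulr0 mul0r => b2_le0; have -> : b = 0.
    by apply/eqP; rewrite -sqrf_eq0 eq_le b2_le0 sqr_ge0.
  by rewrite !mul0r subr0 add0r mulr_ge0// sqr_ge0.
rewrite -(pmulr_rge0 _ (_ : 0 < 4 * a)) ?mulr_gt0//.
rewrite (_ : 4 * a * _ = (2 * a * x - b * y) ^+ 2 +
  (4 * a * d - b ^+ 2) * y ^+ 2); last by ring.
by rewrite addr_ge0 ?sqr_ge0// mulr_ge0 ?sqr_ge0// subr_ge0.
Qed.

Definition delay (R : nmodType) (c : nat -> R) (d n : nat) : R :=
  if (d <= n)%N then c (n - d)%N else 0.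

(** With c_n = C_n(t,x), a = - alpha', b = alpha^2 E(t,x) and d = alpha/(2 gamma), this is the
    pointwise contribution of mode n, fluxes apart, to the gap in the energy inequality. In 2n+1,
    the 2n comes from the scheme and the 1 from differentiating the factor alpha of the squared
    norm. *)
Definition moment_term (R : rcfType) (c : nat -> R) (a b d : R) (n : nat) : R :=
  a * (n.*2.+1%:R * c n ^+ 2 + 2 * (Num.sqrt (n.-1 * n)%:R * delay c 2 n * c n))
  + d * c n ^+ 2 - 2 * b * (Num.sqrt n%:R * delay c 1 n * c n).

(* With [D_n = sqrt n c_n + sqrt (n - 1) c_(n - 2)], the factor of [a] sums to
   the sum of the [D_n ^+ 2] and the factor of [b] to that of the [c_(n - 1) D_n],
   up to boundary terms: the form is a sum of [quadratic_form_ge0] at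
   [D_n, c_(n - 1)]. *)
Lemma moment_form_ge0 (R : rcfType) (c : nat -> R) (a b d : R) (N : nat) :
  0 <= a -> 0 <= d -> b ^+ 2 <= 4 * a * d ->
  0 <= \sum_(n < N) moment_term c a b d n.
Proof.
move=> a0 d0 disc.
case: N => [|[|M]]; first by rewrite big_ord0.
  rewrite big_ord1 /moment_term /= /delay/= mul0n sqrtr0 !mul0r !mulr0 addr0 subr0.
  by rewrite mul1r addr_ge0// mulr_ge0// sqr_ge0.
have sq m : Num.sqrt m%:R ^+ 2 = m%:R :> R by rewrite sqr_sqrtr.
(* The left side is what the squares [D_n] with n < M+2 leave over. The last two modes have no
   successor [D_(M+2)], [D_(M+3)] to consume the other part of their coefficient 2n+1, and the last
   product c_M c_(M+1) and square c_(M+1)^2 are only partly consumed. *)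
suff boundary : a * M.+1%:R * c M ^+ 2 + a * M.+2%:R * c M.+1 ^+ 2
    - b * (Num.sqrt M.+1%:R * c M.+1 * c M) + d * c M.+1 ^+ 2
    <= \sum_(n < M.+2) moment_term c a b d n.
  apply: le_trans boundary.
  (* The leftover is itself a form at (sqrt(M+1) c_M, c_(M+1)), plus a nonnegative square. *)
  have := quadratic_form_ge0 (Num.sqrt M.+1%:R * c M) (c M.+1) a0 d0 disc.
  rewrite exprMn sq => Q.
  have : 0 <= a * M.+2%:R * c M.+1 ^+ 2 by rewrite mulr_ge0 ?sqr_ge0// mulr_ge0.
  lra.
elim: M => [|M IH].
  rewrite big_ord_recr big_ord1 /moment_term /= /delay/=.
  rewrite !mul0n sqrtr0 !mul0r !mulr0 sqrtr1.
  have := quadratic_form_ge0 (c 1%N) (c 0%N) a0 d0 disc.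
  rewrite !mul1r subnn -[0.*2.+1]/1%N -[1.*2.+1]/3%N; lra.
rewrite big_ord_recr /=; apply: le_trans (lerD IH (lexx _)).
rewrite /moment_term /delay/= !subSS !subn0 natrM sqrtrM//.
(* Adding mode M+2 raises the sum minus its leftover by exactly the form at [D_(M+2)], c_(M+1). *)
have := quadratic_form_ge0
  (Num.sqrt M.+2%:R * c M.+2 + Num.sqrt M.+1%:R * c M) (c M.+1) a0 d0 disc.
move: (sq M.+1) (sq M.+2).
have -> : M.+2.*2.+1%:R = M.+2%:R + M.+2%:R + 1 :> R.
  by rewrite -addn1 -addnn !natrD.
have -> : M.+3%:R = 1 + M.+2%:R :> R by rewrite -natr1 addrC.
have -> : M.+2%:R = 1 + M.+1%:R :> R by rewrite -natr1 addrC.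
move: (Num.sqrt _) (Num.sqrt _) => s1 s2 <- s2E.
set Q := (X in 0 <= X -> _) => Q0; rewrite -subr_ge0.
rewrite (_ : _ - _ = Q)//; rewrite /Q.
have -> : a * (s1 * c M.+2 + s2 * c M) ^+ 2 = a * ((1 + s2 ^+ 2) * c M.+2 ^+ 2
   + 2 * s1 * s2 * c M * c M.+2 + s2 ^+ 2 * c M ^+ 2) by rewrite -s2E; ring.
ring.
Qed.

Lemma sum_shift_periodic (V : zmodType) (N : nat) (F : nat -> V) :
  F 0%N = F N -> \sum_(j < N) F j.+1 = \sum_(j < N) F j.
Proof.
move=> F0N; apply: (addrI (F 0%N)).
by rewrite -(big_ord_recl N (fun j => F j)) big_ord_recr/= addrC F0N.
Qed.

(** * Numerical fluxes with periodic boundary conditions *)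

Section periodic_flux.
Variables (R : realType) (Nx : nat) (node : nat -> R).

Definition trL (u : nat -> {poly R}) (i : nat) : R :=
  if i == 0%N then (u Nx.-1).[node Nx] else (u i.-1).[node i].

Definition trR (u : nat -> {poly R}) (i : nat) : R :=
  if i == Nx then (u 0%N).[node 0%N] else (u i).[node i].

Lemma trL_periodic u : trL u 0%N = trL u Nx.
Proof. by rewrite /trL eqxx; case: eqP => // ->. Qed.

Lemma trR_periodic u : trR u 0%N = trR u Nx.
Proof. by rewrite /trR eqxx; case: eqP. Qed.

Lemma sum_flux (fl : nat -> R) (u : nat -> {poly R}) : fl 0%N = fl Nx ->
  \sum_(j < Nx) (fl j.+1 * (u j).[node j.+1] - fl j * (u j).[node j]) =
  \sum_(j < Nx) fl j * (trL u j - trR u j).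
Proof.
move=> fl_periodic.
under [RHS]eq_bigr do rewrite mulrBr.
rewrite !sumrB; congr (_ - _); last first.
  by apply: eq_bigr => j _; rewrite /trR ltn_eqF.
rewrite -(@sum_shift_periodic _ _ (fun j => fl j * trL u j)) //.
by rewrite fl_periodic trL_periodic.
Qed.

(** The centered-flux discretization, in weak form, of the integral of u' v: volume term, then mean
    of [u] times jump of [v]. *)
Definition bracket (u v : nat -> {poly R}) : R :=
  - (\sum_(j < Nx) pint (node j) (node j.+1) (u j * (v j)^`()))
  + \sum_(j < Nx) 2^-1 * (trL u j + trR u j) * (trL v j - trR v j).

(** Discrete integration by parts. Integrating (uv)' over the cells leaves the jumps of uv at the
    nodes, by periodicity, and the jump of a product is mean(u) jump(v) + mean(v) jump(u). *)
Lemma bracketC u v : (forall j, (j < Nx)%N -> node j < node j.+1) ->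
  bracket u v = - bracket v u.
Proof.
move=> node_lt; apply/eqP; rewrite -subr_eq0 opprK /bracket addrACA.
rewrite -opprD -!big_split/= addrC subr_eq0; apply/eqP.
under [RHS]eq_bigr => j _.
  rewrite -pintD addrC mulrC -derivM pint_deriv ?node_lt// !hornerM.
  rewrite (_ : (u j).[node j.+1] = trL u j.+1)// (_ : (v j).[node j.+1] = trL v j.+1)//.
  rewrite (_ : (u j).[node j] = trR u j); last by rewrite /trR ltn_eqF.
  rewrite (_ : (v j).[node j] = trR v j); last by rewrite /trR ltn_eqF.
  over.
have shift_periodic := @sum_shift_periodic _ Nx (fun j => trL u j * trL v j).
rewrite sumrB shift_periodic; last by rewrite !trL_periodic.
rewrite -sumrB; apply: eq_bigr => j _; lra.
Qed.

Lemma bracketZl (c : R) u v : bracket (fun j => c *: u j) v = c * bracket u v.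
Proof.
rewrite /bracket mulrDr mulrN !mulr_sumr; congr (- _ + _).
  by apply: eq_bigr => j _; rewrite -scalerAl pintZ.
apply: eq_bigr => j _; rewrite (_ : trL _ j = c * trL u j); last first.
  by rewrite /trL; case: ifP => _; rewrite hornerZ.
rewrite (_ : trR (fun _ => _) j = c * trR u j); last first.
  by rewrite /trR; case: ifP => _; rewrite hornerZ.
ring.
Qed.

Lemma bracketDl u1 u2 v :
  bracket (fun j => u1 j + u2 j) v = bracket u1 v + bracket u2 v.
Proof.
rewrite /bracket addrACA -opprD -!big_split/=; congr (- _ + _).
  by apply: eq_bigr => j _; rewrite mulrDl pintD.
apply: eq_bigr => j _; rewrite (_ : trL _ j = trL u1 j + trL u2 j); last first.
  by rewrite /trL; case: ifP => _; rewrite hornerD.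
rewrite (_ : trR (fun _ => _) j = trR u1 j + trR u2 j); last first.
  by rewrite /trR; case: ifP => _; rewrite hornerD.
ring.
Qed.

(** For [n = 0] the index [n.-1] is 0 instead of -1, but its factor sqrt 0 removes the term. *)
Definition gpoly (al : R) (P : nat -> nat -> {poly R}) (n j : nat) : {poly R} :=
  al^-1 *: (Num.sqrt n.+1%:R *: P n.+1 j + Num.sqrt n%:R *: P n.-1 j).

Definition upwind_flux (al : R) (de : nat -> R) (P : nat -> nat -> {poly R})
    (n i : nat) : R :=
  2^-1 * (trL (gpoly al P n) i + trR (gpoly al P n) i
          - de n * (trR (P n) i - trL (P n) i)).

Definition cell_form (al : R) (de : nat -> R) (P : nat -> nat -> {poly R})
    (n j : nat) : R :=
  - pint (node j) (node j.+1) (gpoly al P n j * (P n j)^`())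
  + upwind_flux al de P n j.+1 * (P n j).[node j.+1]
  - upwind_flux al de P n j * (P n j).[node j].

Lemma sum_cell_form (al : R) (de : nat -> R) (P : nat -> nat -> {poly R})
    (n : nat) :
  \sum_(j < Nx) cell_form al de P n j =
  al^-1 * (Num.sqrt n.+1%:R * bracket (P n.+1) (P n)
           + Num.sqrt n%:R * bracket (P n.-1) (P n))
  + de n / 2 * \sum_(j < Nx) (trR (P n) j - trL (P n) j) ^+ 2.
Proof.
rewrite -!bracketZl -bracketDl -bracketZl /bracket.
under eq_bigr do rewrite /cell_form -addrA.
rewrite big_split/= sum_flux; last first.
  by rewrite /upwind_flux !trL_periodic !trR_periodic.
rewrite sumrN -addrA; congr (_ + _); rewrite mulr_sumr -big_split/=.
apply: eq_bigr => j _; rewrite /upwind_flux /gpoly.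
move: (trL (P n) j) (trR (P n) j) => l r; ring.
Qed.

(* The volume terms and the centered part of the fluxes form an antisymmetric
   bracket, so that the sum over the modes telescopes and only the penalization
   of the jumps remains. *)
Lemma sum_cell_form_ge0 (al : R) (de : nat -> R) (P : nat -> nat -> {poly R})
    (N : nat) : (forall j, (j < Nx)%N -> node j < node j.+1) ->
  (forall n, 0 <= de n) -> (forall j, P N j = 0) ->
  0 <= \sum_(n < N) \sum_(j < Nx) cell_form al de P n j.
Proof.
move=> node_lt de0 PN0.
under eq_bigr do rewrite sum_cell_form.
rewrite big_split/= -mulr_sumr.
have telescope m : \sum_(n < m) (Num.sqrt n.+1%:R * bracket (P n.+1) (P n) +
    Num.sqrt n%:R * bracket (P n.-1) (P n)) =
    Num.sqrt m%:R * bracket (P m) (P m.-1).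
  elim: m => [|m IH]; first by rewrite big_ord0 sqrtr0 mul0r.
  by rewrite big_ord_recr/= IH (bracketC (P m.-1))// mulrN addrC addrNK.
(* The single surviving bracket contains mode N, which the truncation sets to zero. *)
rewrite telescope (_ : bracket (P N) _ = 0); last first.
  have -> : P N = fun j => 0 *: P N j by apply/funext => j; rewrite scale0r PN0.
  by rewrite bracketZl mul0r.
rewrite !mulr0 add0r; apply: sumr_ge0 => n _; apply: mulr_ge0.
  by rewrite divr_ge0.
by apply: sumr_ge0 => j _; exact: sqr_ge0.
Qed.

End periodic_flux.

(** * Orthonormality of the Hermite functions *)

(** The density of a centered normal variable with standard deviation 1/al, as [Psi] contains it. *)
Definition gauss (R : realType) (al v : R) : R :=
  al * (expR (- ((al * v) ^+ 2 / 2)) / Num.sqrt (2 * pi)).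

Definition gauss_poly (R : realType) (al : R) (p : {poly R}) (v : R) : R :=
  p.[al * v] * gauss al v.

Lemma sqrt2pi_gt0 (R : realType) : 0 < Num.sqrt (2 * pi) :> R.
Proof. by rewrite sqrtr_gt0 mulr_gt0// pi_gt0. Qed.

Lemma gauss_ge0 (R : realType) (al v : R) : 0 < al -> 0 <= gauss al v.
Proof.
by move=> al0; rewrite !mulr_ge0 ?expR_ge0 ?invr_ge0 ?sqrtr_ge0// ltW.
Qed.

Lemma gauss_normal_pdf (R : realType) (al v : R) : 0 < al ->
  gauss al v = normal_pdf 0 al^-1 v.
Proof.
move=> al0; rewrite normal_pdfE ?invr_eq0 ?gt_eqF//.
rewrite /normal_peak /normal_fun subr0 /gauss.
have -> : al^-1 ^+ 2 * pi *+ 2 = al^-1 ^+ 2 * (2 * pi) by rewrite -mulr_natr; ring.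
rewrite [Num.sqrt (al^-1 ^+ 2 * _)]sqrtrM ?sqr_ge0// sqrtr_sqr.
rewrite ger0_norm ?invr_ge0 ?ltW// invfM invrK.
have -> : - v ^+ 2 / (al^-1 ^+ 2 *+ 2) = - ((al * v) ^+ 2 / 2).
  by rewrite -mulr_natr; field; rewrite gt_eqF.
ring.
Qed.

Lemma is_derive_gauss_poly (R : realType) (al v : R) (p : {poly R}) :
  is_derive v 1 (gauss_poly al p) (gauss_poly al (al *: (p^`() - p * 'X)) v).
Proof.
have dp : is_derive v 1 (fun v => p.[al * v]) (p^`().[al * v] * al).
  apply: (@is_derive1_comp _ (horner p) (fun v => al * v)).
  by apply: trigger_derive; rewrite /GRing.scale/= mulr1.
apply: trigger_derive.
rewrite /GRing.scale/= /gauss_poly hornerZ hornerD hornerN hornerM hornerX.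
rewrite /gauss; field.
by rewrite gt_eqF// sqrt2pi_gt0.
Qed.

Lemma continuous_gauss_poly (R : realType) (al : R) (p : {poly R}) :
  continuous (gauss_poly al p).
Proof.
move=> v; apply/differentiable_continuous/derivable1_diffP.
by have [] := is_derive_gauss_poly al v p.
Qed.

(** The exponent is half that of the Gaussian: a polynomial times a Gaussian is then bounded by a
    wider Gaussian, of scale al / sqrt 2, whose integrability is known. *)
Lemma horner_le_expR (R : realType) (p : {poly R}) :
  exists2 K, 0 <= K & forall x, `|p.[x]| <= K * expR (x ^+ 2 / 4).
Proof.
have powX n : exists2 K : R, 0 <= K & forall x, `|x| ^+ n <= K * expR (x ^+ 2 / 4).
  case: n => [|n].
    exists 1 => // x; rewrite expr0 mul1r (le_trans _ (expR_ge1Dx _))//.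
    by rewrite lerDl divr_ge0 ?sqr_ge0.
  (* With this [m], exp(x^2/4) is the (n+1)-st power of exp(x^2/m), so it suffices to compare |x|
     with (m+1) exp(x^2/m). *)
  pose m : R := 4 * n.+1%:R; have m0 : 0 < m by rewrite mulr_gt0.
  exists ((m + 1) ^+ n.+1) => [|x]; first by rewrite exprn_ge0// addr_ge0// ltW.
  have -> : x ^+ 2 / 4 = n.+1%:R * (x ^+ 2 / m) by rewrite /m; field.
  rewrite expRM_natl -exprMn.
  rewrite ler_pXn2r ?nnegrE ?mulr_ge0 ?expR_ge0 ?addr_ge0 ?(ltW m0)//.
  have xm : x ^+ 2 = m * (x ^+ 2 / m) by rewrite mulrCA mulfV ?mulr1// gt_eqF.
  have := expR_ge1Dx (x ^+ 2 / m); have : 0 <= x ^+ 2 / m.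
    by rewrite divr_ge0 ?sqr_ge0// ltW.
  move: (x ^+ 2 / m) xm => y xm y0; move: (expR y) => e ye.
  have : `|x| <= 1 + x ^+ 2.
    by rewrite -real_normK ?num_real//; have := sqr_ge0 (`|x| - 2^-1); nra.
  nra.
(* The extra power of |x| absorbs the factor X in the induction on the polynomial. *)
suff : forall n, exists2 K, 0 <= K &
    forall x, `|p.[x]| * `|x| ^+ n <= K * expR (x ^+ 2 / 4).
  by move=> /(_ 0%N) [K K0 KP]; exists K => // x; have := KP x; rewrite expr0 mulr1.
elim/poly_ind: p => [|p c IH] n.
  by exists 0 => // x; rewrite horner0 normr0 !mul0r.
have [[K K0 KP] [K' K'0 K'P]] := (IH n.+1, powX n).
exists (K + `|c| * K') => [|x]; first by rewrite addr_ge0// mulr_ge0.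
rewrite !hornerE mulrDl (le_trans (ler_wpM2r _ (ler_normD _ _))) ?exprn_ge0//.
rewrite mulrDl normrM -mulrA -exprS lerD//.
by rewrite -mulrA ler_wpM2l.
Qed.

Lemma gauss_poly_bound (R : realType) (al : R) (p : {poly R}) : 0 < al ->
  exists2 K, 0 <= K &
    forall v, `|gauss_poly al p v| <= K * gauss (al / Num.sqrt 2) v.
Proof.
move=> al0; have [K K0 KP] := horner_le_expR p.
exists (K * Num.sqrt 2) => [|v]; first by rewrite mulr_ge0// sqrtr_ge0.
rewrite normrM [`|gauss _ _|]ger0_norm ?gauss_ge0//.
apply: (le_trans (ler_wpM2r (gauss_ge0 _ al0) (KP _))).
rewrite /gauss (_ : (al / Num.sqrt 2 * v) ^+ 2 = (al * v) ^+ 2 / 2); last first.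
  by rewrite !exprMn exprVn sqr_sqrtr//; ring.
have -> : - ((al * v) ^+ 2 / 2) = - ((al * v) ^+ 2 / 4) - (al * v) ^+ 2 / 4 by field.
have -> : - ((al * v) ^+ 2 / 2 / 2) = - ((al * v) ^+ 2 / 4) by field.
rewrite expRD expRN; have := expR_gt0 ((al * v) ^+ 2 / 4).
move: (expR _) (sqrt2pi_gt0 R) => e; move: (Num.sqrt (2 * pi)) => s s0 e0.
have : 0 < Num.sqrt 2 :> R by rewrite sqrtr_gt0.
move: (Num.sqrt 2) => r r0; rewrite le_eqVlt; apply/orP; left; apply/eqP; field.
by rewrite !gt_eqF.
Qed.

Lemma integrable_gauss_poly (R : realType) (al : R) (p : {poly R}) : 0 < al ->
  (@lebesgue_measure R).-integrable setT (EFin \o gauss_poly al p).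
Proof.
move=> al0; have [K K0 KP] := gauss_poly_bound p al0.
have be0 : 0 < al / Num.sqrt 2 by rewrite divr_gt0// sqrtr_gt0.
apply: (@le_integrable _ _ R lebesgue_measure setT measurableT _
  (fun v => K%:E * (normal_pdf 0 (al / Num.sqrt 2)^-1 v)%:E)%E) => //.
- apply/measurable_EFinP; apply: continuous_measurable_fun.
  exact: continuous_gauss_poly.
- move=> v _; rewrite -EFinM lee_fin -gauss_normal_pdf//.
  by rewrite (le_trans (KP v))// ler_norm.
- by apply: integrableZl => //; exact: integrable_normal_pdf.
Qed.

Definition gauss_int (R : realType) (al : R) (p : {poly R}) : R :=
  \int[@lebesgue_measure R]_v gauss_poly al p v.

Lemma gauss_intD (R : realType) (al : R) (p q : {poly R}) : 0 < al ->
  gauss_int al (p + q) = gauss_int al p + gauss_int al q.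
Proof.
move=> al0; rewrite /gauss_int -RintegralD//; try exact: integrable_gauss_poly.
by apply: eq_Rintegral => v _; rewrite /gauss_poly hornerD mulrDl.
Qed.

Lemma gauss_intZ (R : realType) (al c : R) (p : {poly R}) : 0 < al ->
  gauss_int al (c *: p) = c * gauss_int al p.
Proof.
move=> al0; rewrite /gauss_int -RintegralZl//; last exact: integrable_gauss_poly.
by apply: eq_Rintegral => v _; rewrite /gauss_poly hornerZ -mulrA.
Qed.

Lemma gauss_intB (R : realType) (al : R) (p q : {poly R}) : 0 < al ->
  gauss_int al (p - q) = gauss_int al p - gauss_int al q.
Proof. by move=> al0; rewrite -scaleN1r gauss_intD// gauss_intZ// mulN1r. Qed.

Lemma gauss_int0 (R : realType) (al : R) : 0 < al -> gauss_int al 0 = 0.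
Proof. by move=> al0; rewrite -(subrr 0) gauss_intB// subrr. Qed.

Lemma gauss_int1 (R : realType) (al : R) : 0 < al -> gauss_int al 1 = 1.
Proof.
move=> al0; rewrite /gauss_int /Rintegral.
have -> : gauss_poly al 1 = normal_pdf 0 al^-1.
  apply/funext => v.
  by rewrite /gauss_poly -polyC1 hornerC mul1r gauss_normal_pdf.
by rewrite integral_normal_pdf.
Qed.

Lemma gauss_poly_cvg0 (R : realType) (al e : R) (p : {poly R}) : 0 < al ->
  e ^+ 2 = 1 -> gauss_poly al p (e * n%:R) @[n --> \oo] --> (0 : R).
Proof.
move=> al0 e2; have [K K0 KP] := gauss_poly_bound p al0.
have [be be0 {}KP] : exists2 be, 0 < be &
    forall v, `|gauss_poly al p v| <= K * gauss be v.
  by exists (al / Num.sqrt 2) => //; rewrite divr_gt0// sqrtr_gt0.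
pose c := be ^+ 2 / 2; have c0 : 0 < c by rewrite divr_gt0// exprn_gt0.
(* From exp(c n^2) >= 1 + c n^2 and n + 1 <= (2 + 1/c)(1 + c n^2), the Gaussian decays at least like
   1/(n+1). *)
pose M := K * (be / Num.sqrt (2 * pi) * (2 + c^-1)).
apply/norm_cvg0P.
apply: (@squeeze_cvgr _ _ _ _ (cst 0) (fun n => M * harmonic n)); last 2 first.
- exact: cvg_cst.
- by rewrite -(mulr0 M); apply: cvgMr; exact: cvg_harmonic.
apply: nearW => n; rewrite normr_ge0/= (le_trans (KP _))// /M -mulrA ler_wpM2l//.
rewrite /gauss (_ : (be * (e * n%:R)) ^+ 2 / 2 = c * n%:R ^+ 2); last first.
  by rewrite !exprMn e2 /c; ring.
rewrite -[be / _ * _]mulrA -[be * _ * _]mulrA ler_wpM2l ?(ltW be0)//.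
rewrite [_ / Num.sqrt _]mulrC -mulrA ler_wpM2l ?invr_ge0 ?sqrtr_ge0//.
rewrite expRN /harmonic/= ler_pdivlMr ?ltr0n// mulrC ler_pdivrMr ?expR_gt0//.
have := expR_ge1Dx (c * n%:R ^+ 2); set E := expR _ => E1.
apply: (@le_trans _ _ ((2 + c^-1) * (1 + c * n%:R ^+ 2))); last first.
  by rewrite ler_wpM2l// addr_ge0// invr_ge0 ltW.
have -> : (2 + c^-1) * (1 + c * n%:R ^+ 2) =
    2 + c^-1 + 2 * (c * n%:R ^+ 2) + n%:R ^+ 2 by field; rewrite gt_eqF.
have : 0 <= c * n%:R ^+ 2 by rewrite mulr_ge0 ?(ltW c0)// sqr_ge0.
have : 0 < c^-1 by rewrite invr_gt0.
have : 0 <= (n%:R - 1) ^+ 2 :> R by exact: sqr_ge0.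
have := sqr_ge0 (n%:R : R).
have -> : n.+1%:R = n%:R + 1 :> R by rewrite natr1.
lra.
Qed.

Lemma itv_Nnn_cvg (R : realType) (g : R -> R) :
  (@lebesgue_measure R).-integrable setT (EFin \o g) ->
  (\int[@lebesgue_measure R]_(v in `[(- n%:R)%R, n%:R%R]) (g v)%:E)%E @[n --> \oo] -->
  (\int[@lebesgue_measure R]_v (g v)%:E)%E.
Proof.
move=> ig; have mg := measurable_int _ ig.
pose g_ (n : nat) : R -> \bar R := (EFin \o g) \_ `[- (n%:R : R), n%:R].
have mg_ n : measurable_fun setT (g_ n).
  by apply/(measurable_restrictT _ _).1 => //; exact: measurable_funTS.
have cg : {ae @lebesgue_measure R, forall x, setT x ->
    g_ ^~ x @ \oo --> (EFin \o g) x}.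
  apply: aeW => x _; apply: cvg_near_cst.
  near=> n; rewrite /g_ patchE mem_set//= in_itv/= -ler_norml.
  by near: n; exact: nbhs_infty_ger.
have dg : {ae @lebesgue_measure R, forall x (n : nat), setT x ->
    (`|g_ n x| <= (abse \o (EFin \o g)) x)%E}.
  apply: aeW => x n _; rewrite /g_ patchE.
  by case: ifP => _ /=; rewrite lee_fin ?normr0.
have [_ _] := @dominated_convergence _ _ R lebesgue_measure setT measurableT g_
  (EFin \o g) _ mg_ mg cg (integrable_abse ig) dg.
apply: cvg_trans; apply: near_eq_cvg; apply: nearW => n /=.
by rewrite /g_ -integral_mkcond.
Unshelve. all: by end_near. Qed.

(** Gaussian integration by parts (Stein's identity): al (p' - pX) times the Gaussian is the
    derivative of [gauss_poly al p], which vanishes at both infinities. *)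
Lemma gauss_int_deriv (R : realType) (al : R) (p : {poly R}) : 0 < al ->
  gauss_int al p^`() = gauss_int al (p * 'X).
Proof.
move=> al0; suff : gauss_int al (al *: (p^`() - p * 'X)) = 0.
  rewrite gauss_intZ// => /eqP; rewrite mulf_eq0 gt_eqF//=.
  by rewrite gauss_intB// subr_eq0 => /eqP.
set q := al *: _.
have iq := integrable_gauss_poly q al0.
have := itv_Nnn_cvg iq.
have ftc (n : nat) : (0 < n)%N ->
    (\int[@lebesgue_measure R]_(v in `[(- n%:R)%R, n%:R%R]) (gauss_poly al q v)%:E)%E =
    (gauss_poly al p n%:R - gauss_poly al p (- n%:R))%:E.
  move=> n0; rewrite (@continuous_FTC2 _ _ (gauss_poly al p))//.
  - by rewrite gtrN ?ltr0n.
  - by apply: continuous_subspaceT; exact: continuous_gauss_poly.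
  - split; first by move=> x _; have [] := is_derive_gauss_poly al x p.
    + by apply: cvg_at_right_filter; exact: continuous_gauss_poly.
    + by apply: cvg_at_left_filter; exact: continuous_gauss_poly.
  - move=> x _; rewrite derive1E; apply: derive_val.
    exact: is_derive_gauss_poly.
set I := (X in _ --> X) => cvgI.
have cvg0 : (\int[@lebesgue_measure R]_(v in `[(- n%:R)%R, n%:R%R])
    (gauss_poly al q v)%:E)%E @[n --> \oo] --> (0%:E : \bar R).
  have : (gauss_poly al p n%:R - gauss_poly al p (- n%:R))%:E @[n --> \oo]
      --> (0%:E : \bar R).
    apply: cvg_EFin; first by near=> n.
    rewrite -[X in _ --> X](subr0 0); apply: cvgB.
      under eq_fun do rewrite -[_%:R]mul1r.
      by apply: gauss_poly_cvg0; rewrite // expr1n.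
    under eq_fun do rewrite -[- _%:R]mulN1r.
    by apply: gauss_poly_cvg0; rewrite // sqrrN expr1n.
  apply: cvg_trans; apply: near_eq_cvg; near=> n; rewrite ftc//.
  by near: n; exact: nbhs_infty_gt.
by rewrite /gauss_int /Rintegral -/I (cvg_unique _ cvgI cvg0).
Unshelve. all: by end_near. Qed.

(** * Hermite polynomials *)

Fixpoint hermite_poly (R : realType) (n : nat) : {poly R} :=
  match n with
  | 0 => 1
  | n'.+1 =>
    (Num.sqrt n'.+1%:R)^-1 *:
    ('X * hermite_poly R n' -
     (if n' is n''.+1 then Num.sqrt n'%:R *: hermite_poly R n'' else 0))
  end.

Lemma hermiteE (R : realType) (n : nat) (x : R) :
  hermite n x = (hermite_poly R n).[x].
Proof.
elim/ltn_ind: n => -[|[|n]] IH; first by rewrite /= hornerC.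
  by rewrite /= !subr0 !mulr1 hornerZ hornerX.
rewrite (_ : hermite_poly R n.+2 = (Num.sqrt n.+2%:R)^-1 *:
  ('X * hermite_poly R n.+1 - Num.sqrt n.+1%:R *: hermite_poly R n))//.
rewrite (_ : hermite n.+2 x = (Num.sqrt n.+2%:R)^-1 *
  (x * hermite n.+1 x - Num.sqrt n.+1%:R * hermite n x))//.
by rewrite hornerZ hornerD hornerN hornerM hornerX (hornerZ (Num.sqrt n.+1%:R)) !IH.
Qed.

Lemma sqrt_natS_neq0 (R : realType) (n : nat) : Num.sqrt n.+1%:R != 0 :> R.
Proof. by rewrite gt_eqF// sqrtr_gt0. Qed.

Lemma hermite_polyS (R : realType) (n : nat) :
  Num.sqrt n.+1%:R *: hermite_poly R n.+1 =
  'X * hermite_poly R n - Num.sqrt n%:R *: hermite_poly R n.-1.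
Proof.
rewrite scalerA mulfV ?sqrt_natS_neq0// scale1r.
by case: n => //=; rewrite sqrtr0 scale0r.
Qed.

Lemma deriv_hermite_poly (R : realType) (n : nat) :
  (hermite_poly R n)^`() = Num.sqrt n%:R *: hermite_poly R n.-1.
Proof.
elim/ltn_ind: n => -[|n] IH; first by rewrite /= derivC sqrtr0 scale0r.
apply: (scalerI (sqrt_natS_neq0 R n)).
rewrite -derivZ hermite_polyS scalerA -expr2 sqr_sqrtr// -[n.+1.-1]/n.
rewrite derivB derivM derivX mul1r derivZ (IH n)//.
case: n IH => [|n] IH; first by rewrite /= sqrtr0 !scale0r mulr0 !addr0 subr0 scale1r.
rewrite -[n.+1.-1]/n (IH n)// -scalerAr -addrA -scalerBr -hermite_polyS scalerA -expr2.
by rewrite sqr_sqrtr// -[X in X + _]scale1r -scalerDl nat1r.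
Qed.

(** Since sqrt(k+1) H_(k+1) = X H_k - H_k', raising the index is adjoint to differentiation for the
    Gaussian, while differentiation lowers the index. Both indices thus descend together until one
    is 0. *)
Lemma gauss_int_hermite (R : realType) (al : R) (n m : nat) : 0 < al ->
  gauss_int al (hermite_poly R n * hermite_poly R m) = (n == m)%:R.
Proof.
move=> al0; have raise k q : Num.sqrt k.+1%:R * gauss_int al (hermite_poly R k.+1 * q)
    = gauss_int al (hermite_poly R k * q^`()).
  rewrite -gauss_intZ// scalerAl hermite_polyS -deriv_hermite_poly mulrBl.
  have -> : hermite_poly R k * q^`() = (hermite_poly R k * q)^`()
      - (hermite_poly R k)^`() * q by rewrite derivM addrAC subrr add0r.
  rewrite !gauss_intB// gauss_int_deriv//.
  by congr (gauss_int al _ - _); rewrite [RHS]mulrC mulrA.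
have zero k : gauss_int al (hermite_poly R k.+1) = 0.
  apply: (mulfI (sqrt_natS_neq0 R k)); rewrite mulr0 -[hermite_poly _ _]mulr1.
  by rewrite raise -polyC1 derivC mulr0 gauss_int0.
elim: n m => [|n IH] [|m].
- by rewrite mulr1 gauss_int1.
- by rewrite mul1r zero.
- by rewrite mulr1 zero.
- apply: (mulfI (sqrt_natS_neq0 R n)); rewrite raise deriv_hermite_poly -scalerAr.
  by rewrite gauss_intZ// IH eqSS; case: eqP => [->|_]; rewrite ?mulr0.
Qed.

(** * The weighted norm in terms of the Hermite modes *)

Lemma integrable_setU (d : measure_display) (T : measurableType d)
    (R : realType) (mu : {measure set T -> \bar R}) (A B : set T)
    (f : T -> \bar R) : measurable A -> measurable B -> [disjoint A & B] ->
  mu.-integrable A f -> mu.-integrable B f -> mu.-integrable (A `|` B) f.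
Proof.
move=> mA mB AB /integrableP[mfA ifA] /integrableP[mfB ifB].
have mf : measurable_fun (A `|` B) f by apply/measurable_funU.
apply/integrableP; split => //; rewrite ge0_integral_setU//.
  by rewrite lte_add_pinfty.
exact: measurableT_comp.
Qed.

(** The ordering of the nodes and the integrability are carried along because additivity of the
    integral needs them when the next cell is attached. *)
Lemma piecewise_horner_integral (R : realType) (node : nat -> R) (N : nat)
    (u : R -> R) (r : nat -> {poly R}) :
  (forall j, (j < N)%N -> node j < node j.+1) ->
  (forall j, (j < N)%N -> forall x, node j < x < node j.+1 -> u x = (r j).[x]) ->
  [/\ node 0%N <= node N,
     (@lebesgue_measure R).-integrable `[node 0%N, node N] (EFin \o u) &
     \int[@lebesgue_measure R]_(x in `[node 0%N, node N]) u x =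
     \sum_(j < N) pint (node j) (node j.+1) (r j)].
Proof.
elim: N => [|N IH] node_lt ur.
  rewrite set_itv1 big_ord0 Rintegral_set1; split => //.
  have := @integrable_eq_horner _ (node 0%N) (node 0%N) u 0.
  by rewrite set_itv1; apply => x /andP[ax /(lt_trans ax)]; rewrite ltxx.
have [le0N iu Iu] := IH (fun j jN => node_lt j (ltnW jN)) (fun j jN => ur j (ltnW jN)).
have ltN : node N < node N.+1 by exact: node_lt.
have iuN := integrable_eq_horner (ur N (ltnSn N)).
have iuoc : (@lebesgue_measure R).-integrable `]node N, node N.+1] (EFin \o u).
  by apply: integrableS iuN => //; exact: subset_itv_oc_cc.
have split_itv : `[node 0%N, node N.+1]%classic =
    `[node 0%N, node N] `|` `]node N, node N.+1].
  by rewrite -itv_bndbnd_setU// bnd_simp// ltW.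
have iuS : (@lebesgue_measure R).-integrable `[node 0%N, node N.+1] (EFin \o u).
  rewrite split_itv; apply: integrable_setU => //.
  apply/disj_setPS => x [/=]; rewrite !in_itv/= => /andP[_ xN] /andP[].
  by rewrite ltNge xN.
split => //; first by rewrite (le_trans le0N)// ltW.
rewrite big_ord_recr/= -Iu -(Rintegral_eq_horner (ur N (ltnSn N))).
rewrite -(@Rintegral_itv_obnd_cbnd _ (node N) (BRight (node N.+1)))//.
rewrite -(@Rintegral_itvB _ u (BLeft (node 0%N)))//.
- by rewrite addrC subrK.
- by rewrite bnd_simp ltW.
Qed.

(** The weight cancels one of the two Gaussian factors of f^2 and leaves alpha, so orthonormality
    under a single Gaussian applies. *)
Lemma hermite_expansion_norm (R : realType) (NH : nat) (alpha : R -> R)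
    (C : nat -> R -> R -> R) (t x : R) : 0 < alpha t ->
  (\int[@lebesgue_measure R]_v
     ((`|f_approx NH alpha C t x v| ^+ 2 * weight alpha t v)%R)%:E)%E =
  (alpha t * \sum_(n < NH) C n t x ^+ 2)%:E.
Proof.
move=> al0; pose q := \sum_(n < NH) C n t x *: hermite_poly R n.
have fE v : `|f_approx NH alpha C t x v| ^+ 2 * weight alpha t v =
    gauss_poly (alpha t) (alpha t *: (q ^+ 2)) v.
  rewrite /f_approx.
  rewrite (_ : \sum_(n < NH) _ = q.[alpha t * v] * gauss (alpha t) v); last first.
    rewrite horner_sum mulr_suml; apply: eq_bigr => n _.
    by rewrite hornerZ -hermiteE /Psi /gauss; ring.
  rewrite real_normK ?num_real// /gauss_poly hornerZ horner_exp /gauss /weight.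
  rewrite expRN; move: (expR_gt0 ((alpha t * v) ^+ 2 / 2)) (sqrt2pi_gt0 R).
  by move: (expR _) (Num.sqrt _) => e s e0 s0; field; rewrite !gt_eqF.
under eq_integral do rewrite fE.
have ig := integrable_gauss_poly (alpha t *: (q ^+ 2)) al0.
rewrite -(fineK (integrable_fin_num measurableT ig)); congr EFin.
rewrite -/(Rintegral _ _ _) -/(gauss_int (alpha t) (alpha t *: (q ^+ 2))).
rewrite gauss_intZ//; congr (_ * _).
have gauss_int_sum (F : 'I_NH -> {poly R}) :
    gauss_int (alpha t) (\sum_n F n) = \sum_n gauss_int (alpha t) (F n).
  apply: (big_morph (gauss_int (alpha t))) => [p p'|]; first exact: gauss_intD.
  exact: gauss_int0.
rewrite expr2 /q mulr_suml gauss_int_sum; apply: eq_bigr => n _.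
rewrite mulr_sumr gauss_int_sum (bigD1 n)//= big1 => [|m mn].
  rewrite -scalerAl -scalerAr !gauss_intZ// gauss_int_hermite//.
  by rewrite eqxx addr0 mulr1 -expr2.
rewrite -scalerAl -scalerAr !gauss_intZ// gauss_int_hermite//.
by rewrite eq_sym (inj_eq val_inj) (negPf mn) !mulr0.
Qed.

Lemma weighted_norm_hermite (R : realType) (L : R) (Nx : nat)
    (node : nat -> R) (NH : nat) (alpha : R -> R) (C : nat -> R -> R -> R)
    (P : nat -> nat -> {poly R}) (t : R) : is_partition L Nx node ->
  0 < alpha t ->
  (forall n j, (j < Nx)%N -> forall x, node j < x < node j.+1 ->
    C n t x = (P n j).[x]) ->
  weighted_norm L (weight alpha t) (f_approx NH alpha C t) =
  (Num.sqrt (alpha t * \sum_(j < Nx) \sum_(n < NH)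
     pint (node j) (node j.+1) (P n j ^+ 2)))%:E.
Proof.
move=> [node0 nodeN node_lt] al0 CP; rewrite /weighted_norm.
under eq_integral do rewrite hermite_expansion_norm//.
pose r j := alpha t *: \sum_(n < NH) (P n j ^+ 2).
have ur j : (j < Nx)%N -> forall x, node j < x < node j.+1 ->
    alpha t * (\sum_(n < NH) C n t x ^+ 2) = (r j).[x].
  move=> jN x xj; rewrite hornerZ horner_sum; congr (_ * _).
  by apply: eq_bigr => n _; rewrite horner_exp (CP n j).
have [_ iu Iu] := piecewise_horner_integral node_lt ur.
rewrite node0 nodeN in iu Iu.
rewrite -(fineK (integrable_fin_num _ iu))//=; congr (Num.sqrt _)%:E.
rewrite -/(Rintegral _ _ _) Iu mulr_sumr; apply: eq_bigr => j _.
by rewrite pintZ pint_sum.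
Qed.

(** * Calculus on [0, +oo[ *)

Lemma is_derive_ge0P (R : realType) (f : R -> R) (t l : R) :
  is_derive_ge0 f t l <->
  forall e, 0 < e -> exists2 d, 0 < d & forall s, 0 <= s -> s != t ->
    `|t - s| < d -> `|l - (s - t)^-1 * (f s - f t)| < e.
Proof.
split=> [/cvgrPdist_lt fl e /fl /nbhs_ballP[d /= d0 dP]|fl].
  by exists d => // s s0 st sd; exact: dP.
apply/cvgrPdist_lt => e /fl[d d0 dP]; apply/nbhs_ballP; exists d => //= s sd st s0.
exact: dP.
Qed.

Lemma is_derive_ge0_unique (R : realType) (f : R -> R) (t l : R) : 0 <= t ->
  is_derive_ge0 f t l -> derive_ge0 f t = l.
Proof.
move=> t0 fl; suff FF : ProperFilter (within [set s : R | 0 <= s] t^').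
  exact: (cvg_lim (@Rhausdorff R) fl).
apply: Build_ProperFilter_ex => P /nbhs_ballP[d /= d0 dP].
(* A point to the right of [t] remains in [0, +oo[ even when [t = 0]. *)
exists (t + d / 2); apply: dP => /=.
- rewrite /ball/= opprD addNKr normrN gtr0_norm ?divr_gt0//.
  by rewrite ltr_pdivrMr// ltr_pMr// ltr1n.
- by rewrite -subr_eq0 addrC addKr gt_eqF// divr_gt0.
- by rewrite addr_ge0// divr_ge0// ltW.
Qed.

Lemma eq_is_derive_ge0 (R : realType) (f g : R -> R) (t l : R) : 0 <= t ->
  (forall s, 0 <= s -> f s = g s) -> is_derive_ge0 f t l -> is_derive_ge0 g t l.
Proof.
move=> t0 fg /is_derive_ge0P fl; apply/is_derive_ge0P => e /fl[d d0 dP].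
by exists d => // s s0; rewrite -!fg//; exact: dP.
Qed.

Lemma is_derive_is_derive_ge0 (R : realType) (f : R -> R) (t l : R) :
  is_derive t 1 f l -> is_derive_ge0 f t l.
Proof.
move=> [df dfE]; apply/is_derive_ge0P => e e0.
have : (fun h => h^-1 *: ((f \o shift t) (h *: 1) - f t)) @ 0^' --> l.
  by rewrite -dfE; exact: df.
move=> /cvgrPdist_lt/(_ e e0)/nbhs_ballP[d /= d0 dP]; exists d => // s _ st sd.
have := dP (s - t); rewrite /ball/= sub0r opprB => /(_ sd).
by rewrite subr_eq0 scaler1 subrK; exact.
Qed.

Lemma is_derive_ge0_is_derive (R : realType) (f : R -> R) (t l : R) : 0 < t ->
  is_derive_ge0 f t l -> is_derive t 1 f l.
Proof.
move=> t0 /is_derive_ge0P fl.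
suff dfl : (fun h => h^-1 *: ((f \o shift t) (h *: 1) - f t)) @ 0^' --> l.
  by split; [apply/cvg_ex; exists l|exact: cvg_lim].
apply/cvgrPdist_lt => e /fl[d d0 dP]; apply/nbhs_ballP.
exists (Num.min d t) => [|h]; first by rewrite /= lt_min d0.
rewrite /ball/= sub0r normrN lt_min => /andP[hd ht] h0; rewrite scaler1.
have := dP (h + t); rewrite addrK; apply.
- by move: ht; rewrite ltr_norml => /andP[+ _]; lra.
- by rewrite -subr_eq0 addrK.
- by rewrite opprD addrCA subrr addr0 normrN.
Qed.

Lemma is_derive_ge0_lin (R : realType) (n : nat) (c : 'I_n -> R -> R)
    (dc w : 'I_n -> R) (t : R) : (forall l, is_derive_ge0 (c l) t (dc l)) ->
  is_derive_ge0 (fun s => \sum_l c l s * w l) t (\sum_l dc l * w l).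
Proof.
move=> cdc; rewrite /is_derive_ge0 /diff_quot_ge0.
rewrite (_ : (fun s => _) = fun s =>
    \sum_l ((s - t)^-1 * (c l s - c l t)) * w l); last first.
  apply/funext => s; rewrite -sumrB mulr_sumr; apply: eq_bigr => l _; ring.
apply: cvg_big => [|l _]; first exact: add_continuous.
by apply: cvgMr_tmp; exact: cdc.
Qed.

Lemma is_derive_ge0_sum (R : realType) (n : nat) (c : 'I_n -> R -> R)
    (dc : 'I_n -> R) (t : R) : (forall l, is_derive_ge0 (c l) t (dc l)) ->
  is_derive_ge0 (fun s => \sum_l c l s) t (\sum_l dc l).
Proof.
move=> cdc; have := is_derive_ge0_lin (w := fun=> 1) cdc.
under eq_fun do under eq_bigr do rewrite mulr1.
by under eq_bigr do rewrite mulr1.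
Qed.

(* Freezing a function at its value at [0] for negative times turns statements
   on [0, +oo[ into statements on the whole line. *)
Lemma is_derive_ge0_continuous (R : realType) (f df : R -> R) :
  (forall t, 0 <= t -> is_derive_ge0 f t (df t)) ->
  continuous (fun t : R => f (Num.max t 0)).
Proof.
move=> fdf t; set t' := Num.max t 0.
have t'0 : 0 <= t' by rewrite le_max lexx orbT.
apply/cvgrPdist_lt => e e0; apply/nbhs_ballP.
have /is_derive_ge0P/(_ 1 ltr01)[d d0 dP] := fdf _ t'0.
pose M := `|df t'| + 1; have M0 : 0 < M by rewrite ltr_wpDl.
exists (Num.min d (e / M)) => [|s /=]; first by rewrite /= lt_min d0 divr_gt0.
rewrite /ball/=; rewrite lt_min => /andP[sd se].
set s' := Num.max s 0; have s'0 : 0 <= s' by rewrite le_max lexx orbT.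
have s't' : `|t' - s'| <= `|t - s|.
  have := ler_norm (t - s); have := ler_norm (s - t); rewrite [`|s - t|]distrC.
  by rewrite ler_norml /t' /s'; case: (leP t 0) => ?; case: (leP s 0) => ?; lra.
have [->|st'] := eqVneq s' t'; first by rewrite subrr normr0.
have s't'0 : 0 < `|s' - t'| by rewrite normr_gt0 subr_eq0.
have := dP s' s'0 st' (le_lt_trans s't' sd).
set q := _ * _ => qd; have qM : `|q| < M.
  have -> : q = df t' - (df t' - q) by rewrite subKr.
  by rewrite (le_lt_trans (ler_normB _ _))// ltrD2l.
have -> : f t' - f s' = - ((s' - t') * q).
  by rewrite /q mulrA mulfV ?subr_eq0// mul1r opprB.
rewrite normrN normrM; apply: (@lt_le_trans _ _ (`|s' - t'| * M)).
  by rewrite ltr_pM2l.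
by rewrite -ler_pdivlMr// distrC (le_trans s't')// ltW.
Qed.

Lemma is_derive_quadratic (R : realType) (n : nat) (c : 'I_n -> R -> R)
    (dc : 'I_n -> R) (g : 'I_n -> 'I_n -> R) (t : R) :
  (forall l, is_derive t 1 (c l) (dc l)) ->
  is_derive t 1 (fun s => \sum_l \sum_m c l s * c m s * g l m)
    (\sum_l \sum_m (dc l * c m t + c l t * dc m) * g l m).
Proof.
move=> cdc.
rewrite (_ : (fun s => _) = \sum_l (\sum_m (fun s => c l s * c m s * g l m))).
  apply: is_derive_sum => l; apply: is_derive_sum => m.
  have := cdc l; have := cdc m => dm dl.
  by apply: trigger_derive; rewrite /GRing.scale/=; ring.
by apply/funext => s; rewrite fct_sumE; apply: eq_bigr => l _; rewrite fct_sumE.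
Qed.

(** * Piecewise polynomials and the mixed Poisson problem *)

Definition interp_basis (R : realType) (a b : R) (k : nat) (l : 'I_k.+1) :
    {poly R} :=
  tnth (k.+1.-lagrange (interp_node a b)) l.

(** Defined for every [u] and linear in its sampled values: interpolating the time derivatives of
    these values gives the time derivative of the interpolant. *)
Definition cell_poly (R : realType) (node : nat -> R) (k : nat) (u : R -> R)
    (j : nat) : {poly R} :=
  \sum_(l < k.+1) u (interp_node (node j) (node j.+1) l) *:
    interp_basis (node j) (node j.+1) l.

Lemma size_cell_poly (R : realType) (node : nat -> R) (k : nat) (u : R -> R)
    (j : nat) : node j < node j.+1 -> (size (cell_poly node k u j) <= k.+1)%N.
Proof.
move=> ltj; apply: (leq_trans (size_sum _ _ _)); apply/bigmax_leqP => l _.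
rewrite (leq_trans (size_scale_leq _ _))// size_lagrange_//.
exact: interp_node_inj.
Qed.

Lemma Vh_cell_poly (R : realType) (Nx : nat) (node : nat -> R) (k : nat)
    (u : R -> R) (j : nat) : Vh Nx node k u -> (j < Nx)%N ->
  node j < node j.+1 ->
  forall x, node j < x < node j.+1 -> u x = (cell_poly node k u j).[x].
Proof.
move=> uV jN ltj x xj; have [p sp up] := uV j jN; rewrite up//.
rewrite [p in LHS](lagrange_gen _ (interp_node_inj ltj) sp)// /cell_poly.
congr horner; apply: eq_bigr => l _.
by rewrite mul_polyC up// interp_node_itv.
Qed.

Lemma cell_poly_eq0 (R : realType) (node : nat -> R) (k : nat) (u : R -> R)
    (j : nat) : (forall x, u x = 0) -> cell_poly node k u j = 0.
Proof. by move=> u0; apply: big1 => l _; rewrite u0 scale0r. Qed.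

Lemma horner_lipschitz (R : realType) (a b M : R) (p : {poly R}) : a <= b ->
  (forall x, a <= x <= b -> `|p^`().[x]| <= M) -> `|p.[b] - p.[a]| <= M * (b - a).
Proof.
rewrite le_eqVlt => /predU1P[->|ab] pM; first by rewrite !subrr mulr0 normr0.
rewrite -pint_deriv// -pintC// ler_norml -pintN; apply/andP; split.
  apply: le_pint => x /pM; rewrite ler_norml => /andP[+ _].
  by rewrite hornerN hornerC.
by apply: le_pint => x /pM; rewrite ler_norml hornerC => /andP[].
Qed.

Section mesh.
Variables (R : realType) (L : R) (Nx : nat) (node : nat -> R).
Hypotheses (L_gt0 : 0 < L) (mesh : is_partition L Nx node).

Lemma Nx_gt0 : (0 < Nx)%N.
Proof.
case: mesh => node0 nodeN _; rewrite lt0n; apply: contraTneq L_gt0 => Nx0.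
by rewrite -nodeN Nx0 node0 ltxx.
Qed.

Lemma node_ltS j : (j < Nx)%N -> node j < node j.+1.
Proof. by case: mesh => _ _; exact. Qed.

Lemma node_le i j : (i <= j)%N -> (j <= Nx)%N -> node i <= node j.
Proof.
elim: j => [|j IH]; first by rewrite leqn0 => /eqP ->.
rewrite leq_eqVlt => /predU1P[->//|ij jN].
by rewrite (le_trans (IH ij (ltnW jN)))// ltW// node_ltS.
Qed.

Lemma sum_node_diff : \sum_(j < Nx) (node j.+1 - node j) = L.
Proof.
case: mesh => node0 nodeN _.
rewrite -(big_mkord xpredT (fun j => node j.+1 - node j)) telescope_sumr//.
by rewrite node0 nodeN subr0.
Qed.

Lemma sum_pintC c : \sum_(j < Nx) pint (node j) (node j.+1) c%:P = c * L.
Proof.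
rewrite -sum_node_diff mulr_sumr; apply: eq_bigr => j _.
by rewrite pintC ?node_ltS.
Qed.

Lemma le_sum_pint (p : nat -> {poly R}) M :
  (forall j, (j < Nx)%N -> forall x, cell node j x -> `|(p j).[x]| <= M) ->
  `|\sum_(j < Nx) pint (node j) (node j.+1) (p j)| <= M * L.
Proof.
move=> pM; rewrite ler_norml -mulNr -!sum_pintC; apply/andP.
split; apply: ler_sum => j _; apply: le_pint => x xj; rewrite hornerC;
  have := pM j (ltn_ord j) x; rewrite /cell/= in_itv/= => /(_ xj);
  by rewrite ler_norml => /andP[].
Qed.

(** The closed cells share their nodes, so the slope bounds chain into |u(x) - u(0)| <= M x. The
    zero mean makes L u(0) the integral of u(0) - u, which bounds u(0) by M L as well. *)
Lemma mean0_field_bound (u : R -> R) (q : nat -> {poly R}) (M : R) :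
  (forall j, (j < Nx)%N -> forall x, cell node j x -> u x = (q j).[x]) ->
  (forall j, (j < Nx)%N -> forall x, cell node j x -> `|(q j)^`().[x]| <= M) ->
  \sum_(j < Nx) pint (node j) (node j.+1) (q j) = 0 ->
  forall x, 0 <= x <= L -> `|u x| <= 2 * M * L.
Proof.
move=> uq qM q0; have [node0 nodeN _] := mesh.
have lip i : (i <= Nx)%N -> forall x, 0 <= x <= node i -> `|u x - u 0| <= M * x.
  elim: i => [_|i IH iN] x.
    by rewrite node0 => /le_anti <-; rewrite subrr normr0 mulr0.
  move=> /andP[x0 xi]; have [xlei|/ltW ilex] := leP x (node i).
    by apply: (IH (ltnW iN)); rewrite x0.
  have node_i0 : 0 <= node i by rewrite -node0 node_le// ltnW.
  have := IH (ltnW iN) (node i); rewrite lexx node_i0 => /(_ isT) ui.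
  rewrite -(subrK (u (node i)) (u x)) -addrA (le_trans (ler_normD _ _))//.
  rewrite -[x in leRHS](subrK (node i)) mulrDr lerD//.
  have ci : cell node i (node i) by rewrite /cell/= in_itv/= lexx ltW// node_ltS.
  have cx : cell node i x by rewrite /cell/= in_itv/= ilex.
  rewrite (uq i iN _ ci) (uq i iN _ cx).
  apply: horner_lipschitz => // y /andP[iy yx]; apply: qM => //.
  by rewrite /cell/= in_itv/= iy (le_trans yx).
have M0 : 0 <= M.
  apply: le_trans (qM _ Nx_gt0 (node 0%N) _) => //.
  by rewrite /cell/= in_itv/= lexx ltW// node_ltS// Nx_gt0.
have lipL x : 0 <= x <= L -> `|u x - u 0| <= M * L.
  move=> xL; rewrite (le_trans (lip Nx (leqnn _) x _)) ?nodeN//.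
  by rewrite ler_wpM2l//; case/andP: xL.
have u0 : `|u 0| <= M * L.
  rewrite -(ler_pM2r L_gt0) -[X in _ * X]gtr0_norm// -normrM.
  rewrite -sum_pintC -[X in `|X|]subr0 -[X in _ - X]q0 -sumrB.
  under eq_bigr do rewrite -pintB.
  apply: (@le_sum_pint (fun j => (u 0)%:P - q j)) => j jN x xj.
  rewrite hornerD hornerN hornerC -uq// distrC.
  apply: lipL; move: xj; rewrite /cell/= in_itv/= => /andP[jx xj].
  rewrite -{1}node0 -nodeN (le_trans (node_le (leq0n j) (ltnW jN)))//=.
  by rewrite (le_trans xj)// node_le.
move=> x xL; rewrite -(subrK (u 0) (u x)) (le_trans (ler_normD _ _))//.
by rewrite (_ : 2 * M * L = M * L + M * L) ?lerD ?lipL//; ring.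
Qed.

(** As the mean of the density, [rho] is also bounded by [M]; the slope is then at most 2M, and the
    zero-mean bound doubles it once more. *)
Lemma poisson_bound (u : R -> R) (q p : nat -> {poly R}) (rho M : R) :
  (forall j, (j < Nx)%N -> forall x, cell node j x -> u x = (q j).[x]) ->
  (forall j, (j < Nx)%N -> (q j)^`() = p j - rho%:P) ->
  \sum_(j < Nx) pint (node j) (node j.+1) (q j) = 0 ->
  \sum_(j < Nx) pint (node j) (node j.+1) (p j) = rho * L ->
  (forall j, (j < Nx)%N -> forall x, cell node j x -> `|(p j).[x]| <= M) ->
  forall x, 0 <= x <= L -> `|u x| <= 4 * L * M.
Proof.
move=> uq q'E q0 prho pM x xL.
have rhoM : `|rho| <= M.
  by rewrite -(ler_pM2r L_gt0) -[X in _ * X]gtr0_norm// -normrM -prho le_sum_pint.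
rewrite (_ : 4 * L * M = 2 * (M + M) * L); last by ring.
apply: (mean0_field_bound uq _ q0 xL) => j jN y yj.
rewrite q'E// hornerD hornerN hornerC.
by rewrite (le_trans (ler_normB _ _))// lerD// pM.
Qed.

Lemma derive1_eq_horner (a b x : R) (u : R -> R) (q : {poly R}) :
  (forall y, a < y < b -> u y = q.[y]) -> a < x < b ->
  derive1 u x = q^`().[x].
Proof.
move=> uq /andP[ax xb]; rewrite derive1E (@near_eq_derive _ _ _ _ (horner q)).
  by rewrite derive_val.
near=> y; apply: uq; apply/andP; split; near: y; [exact: lt_nbhsr|exact: lt_nbhsl].
Unshelve. all: by end_near. Qed.

Lemma mixed_poisson_cells (k : nat) (C0 E Phi : R -> R) (p q : nat -> {poly R}) :
  (forall j, (j < Nx)%N -> (size (p j) <= k.+1)%N /\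
     forall x, node j < x < node j.+1 -> C0 x = (p j).[x]) ->
  (forall j, (j < Nx)%N -> (size (q j) <= k.+2)%N /\
     forall x, cell node j x -> E x = (q j).[x]) ->
  mixed_poisson L Nx node k C0 E Phi ->
  exists rho : R, [/\ forall j, (j < Nx)%N -> (q j)^`() = p j - rho%:P,
    \sum_(j < Nx) pint (node j) (node j.+1) (q j) = 0 &
    \sum_(j < Nx) pint (node j) (node j.+1) (p j) = rho * L].
Proof.
move=> C0p Eq [rho rhoE weak]; exists rho.
have [node0 nodeN _] := mesh.
have Ih u r (ur : forall j, (j < Nx)%N -> forall x, node j < x < node j.+1 ->
      u x = (r j).[x]) :
    \int[@lebesgue_measure R]_(x in `[0, L]) u x =
    \sum_(j < Nx) pint (node j) (node j.+1) (r j).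
  by have [_ _] := piecewise_horner_integral node_ltS ur; rewrite node0 nodeN.
have Eoo j : (j < Nx)%N -> forall x, node j < x < node j.+1 -> E x = (q j).[x].
  move=> jN x /andP[jx xj]; have [_ ->//] := Eq j jN.
  by rewrite /cell/= in_itv/= (ltW jx) (ltW xj).
have Wh_cst c : Wh L Nx node k.+1 (fun=> c).
  split=> // [|j jN]; first by move=> x; exact: cvg_cst.
  by exists c%:P => [|x _]; rewrite ?hornerC// (leq_trans (size_polyC_leq1 _)).
split.
- move=> j jN; have [sp pE] := C0p j jN; have [sq _] := Eq j jN.
  (* The test function is the residual itself on cell [j] and zero elsewhere. It is admissible
     because its degree is at most [k], and the weak equation says that its square integrates to
     zero. *)
  pose r := (q j)^`() - (p j - rho%:P).
  have sr : (size r <= k.+1)%N.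
    rewrite (leq_trans (size_polyD _ _))// geq_max size_polyN.
    have -> : (size (q j)^`() <= k.+1)%N.
      have [->|/lt_size_deriv sd] := eqVneq (q j) 0; first by rewrite deriv0 size_poly0.
      by rewrite -ltnS (leq_trans sd).
    rewrite (leq_trans (size_polyD _ _))// geq_max sp size_polyN.
    by rewrite (leq_trans (size_polyC_leq1 _)).
  pose zeta x := if node j < x < node j.+1 then r.[x] else 0.
  have zetaE i : (i < Nx)%N -> forall x, node i < x < node i.+1 ->
      zeta x = (if i == j then r else 0).[x].
    move=> iN x xi; rewrite /zeta; have [<-|ij] := eqVneq i j; first by rewrite xi.
    rewrite horner0; case: ifPn => // xj; exfalso.
    case/andP: xi => ix xi; case/andP: xj => jx xj.
    move: ij; rewrite neq_ltn => /orP[ij|ij].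
    + by have := node_le ij (ltnW jN); rewrite leNgt (lt_trans jx).
    + by have := node_le ij (ltnW iN); rewrite leNgt (lt_trans ix).
  have zetaV : Vh Nx node k zeta.
    move=> i iN; exists (if i == j then r else 0); last exact: zetaE.
    by case: ifP => //; rewrite size_poly0.
  have [_] := weak _ _ (Wh_cst 0) zetaV.
  rewrite (Ih _ (fun i => (q i)^`() * (if i == j then r else 0))); last first.
    by move=> i iN x xi; rewrite hornerM -zetaE// (derive1_eq_horner (Eoo i iN)).
  rewrite (Ih _ (fun i => (p i - rho%:P) * (if i == j then r else 0))); last first.
    move=> i iN x xi; have [_ ->//] := C0p i iN.
    by rewrite hornerM -zetaE// hornerD hornerN hornerC.
  move=> /eqP; rewrite -subr_eq0 -sumrB (bigD1 (Ordinal jN))//= big1 => [|i ij].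
    rewrite eqxx addr0 -pintB -mulrBl -expr2 => /eqP /(pint_sqr_eq0 (node_ltS jN)).
    by move=> /eqP; rewrite subr_eq0 => /eqP.
  by rewrite -(inj_eq val_inj) in ij; rewrite (negPf ij) !mulr0 !pint0 subrr.
- have zeroV : Vh Nx node k (fun=> 0).
    by move=> j _; exists 0 => [|x _]; rewrite ?size_poly0// horner0.
  (* A constant [eta] has zero derivative, so the potential disappears and the mean of [E]
     remains. *)
  have [+ _] := weak _ _ (Wh_cst 1) zeroV.
  rewrite (Ih (fun x => E x * 1) q) => [<-|j jN x xj]; last by rewrite mulr1 (Eoo j).
  rewrite (Ih _ (fun=> 0)); first by rewrite big1// => j _; rewrite pint0.
  by move=> j jN x _; rewrite horner0 derive1_cst mulr0.
- have := rhoE; rewrite (Ih _ (fun j => p j - rho%:P)).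
    under eq_bigr do rewrite pintB.
    by rewrite sumrB sum_pintC => /eqP; rewrite subr_eq0 => /eqP.
  by move=> j jN x xj; have [_ ->//] := C0p j jN; rewrite hornerD hornerN hornerC.
Qed.

End mesh.

(** * The scaling function and the energy of a solution *)

Lemma supnorm_le (R : realType) (L M : R) (u : R -> R) : 0 <= L ->
  (forall x, 0 <= x <= L -> `|u x| <= M) -> supnorm L u <= M.
Proof.
move=> L0 uM; apply: sup_le_ub.
  by exists `|u 0|; exists 0 => //=; rewrite in_itv/= lexx.
by move=> _ [x /= xL <-]; apply: uM; rewrite in_itv in xL.
Qed.

(** On an unbounded set [sup] is only a default value, hence the a priori bound [M]. *)
Lemma le_supnorm (R : realType) (L M x : R) (u : R -> R) :
  (forall x, 0 <= x <= L -> `|u x| <= M) -> 0 <= x <= L -> `|u x| <= supnorm L u.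
Proof.
move=> uM xL; apply: ub_le_sup; last by exists x => //=; rewrite in_itv.
by exists M => _ [y /= yL <-]; apply: uM; rewrite in_itv in yL.
Qed.

Lemma supnorm_triangle (R : realType) (L K M : R) (u v : R -> R) : 0 <= L ->
  (forall x, 0 <= x <= L -> `|v x| <= M) ->
  (forall x, 0 <= x <= L -> `|u x - v x| <= K) ->
  supnorm L u <= supnorm L v + K.
Proof.
move=> L0 vM uvK; apply: supnorm_le => // x xL.
rewrite -(subrK (v x) (u x)) (le_trans (ler_normD _ _))// addrC lerD ?uvK//.
exact: le_supnorm vM xL.
Qed.

(** * One-sided limits at the nodes *)

Lemma lim_at_left_horner (R : realType) (a b : R) (u : R -> R) (p : {poly R}) :
  a < b -> (forall x, a < x < b -> u x = p.[x]) ->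
  lim (u x @[x --> b^'-]) = p.[b].
Proof.
move=> ab up; apply: cvg_lim => //.
have : p.[x] @[x --> b^'-] --> p.[b].
  by apply: cvg_at_left_filter; exact: continuous_horner.
apply: cvg_trans; apply: near_eq_cvg; near=> x; rewrite up//; apply/andP; split.
  by near: x; exact: nbhs_left_gt.
by near: x; exact: nbhs_left_lt.
Unshelve. all: by end_near. Qed.

Lemma lim_at_right_horner (R : realType) (a b : R) (u : R -> R) (p : {poly R}) :
  a < b -> (forall x, a < x < b -> u x = p.[x]) ->
  lim (u x @[x --> a^'+]) = p.[a].
Proof.
move=> ab up; apply: cvg_lim => //.
have : p.[x] @[x --> a^'+] --> p.[a].
  by apply: cvg_at_right_filter; exact: continuous_horner.
apply: cvg_trans; apply: near_eq_cvg; near=> x; rewrite up//; apply/andP; split.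
  by near: x; exact: nbhs_right_gt.
by near: x; exact: nbhs_right_lt.
Unshelve. all: by end_near. Qed.

Section traces.
Variables (R : realType) (L : R) (Nx : nat) (node : nat -> R).
Hypotheses (L_gt0 : 0 < L) (mesh : is_partition L Nx node).
Variables (u : R -> R) (p : nat -> {poly R}).
Hypothesis up :
  forall j, (j < Nx)%N -> forall x, node j < x < node j.+1 -> u x = (p j).[x].

Lemma traceL_trL i : (i <= Nx)%N -> traceL Nx node u i = trL Nx node p i.
Proof.
have left j : (j < Nx)%N -> lim (u x @[x --> (node j.+1)^'-]) = (p j).[node j.+1].
  by move=> jN; exact: lim_at_left_horner (node_ltS mesh jN) (up jN).
rewrite /traceL /trL; case: i => [_|i iN] /=; last by rewrite left.
by have := left Nx.-1; rewrite prednK ?(Nx_gt0 L_gt0 mesh)// => ->.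
Qed.

Lemma traceR_trR i : (i <= Nx)%N -> traceR Nx node u i = trR Nx node p i.
Proof.
have right j : (j < Nx)%N -> lim (u x @[x --> (node j)^'+]) = (p j).[node j].
  by move=> jN; exact: lim_at_right_horner (node_ltS mesh jN) (up jN).
rewrite /traceR /trR leq_eqVlt => /orP[->|iN].
  by rewrite right// (Nx_gt0 L_gt0 mesh).
by rewrite ltn_eqF// right.
Qed.

End traces.

Section solution.
Variables (R : realType) (L alpha0 gamma : R).
Hypotheses (L_gt0 : 0 < L) (alpha0_gt0 : 0 < alpha0) (gamma_gt0 : 0 < gamma).
Variables (Nx : nat) (node : nat -> R) (NH k : nat).
Hypothesis mesh : is_partition L Nx node.
Variables (C : nat -> R -> R -> R) (E Phi : R -> R -> R).
Hypothesis sol : dg_hermite_solution L alpha0 gamma Nx node NH k C E Phi.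

Let mu := @lebesgue_measure R.
Let y (j : nat) (l : 'I_k.+1) : R := interp_node (node j) (node j.+1) l.
Let b (j : nat) (l : 'I_k.+1) : {poly R} := interp_basis (node j) (node j.+1) l.

Definition mode_poly (n : nat) (t : R) (j : nat) : {poly R} :=
  cell_poly node k (C n t) j.

Definition mode_poly_dt (n : nat) (t : R) (j : nat) : {poly R} :=
  cell_poly node k (fun x => derive_ge0 (fun s => C n s x) t) j.

Let P := mode_poly.

Lemma mode_polyE n t j x : 0 <= t -> (j < Nx)%N -> node j < x < node j.+1 ->
  C n t x = (mode_poly n t j).[x].
Proof.
move=> t0 jN xj; apply: (Vh_cell_poly (sol_C_Vh sol n t0) jN) => //.
exact: node_ltS mesh _ jN.
Qed.

Lemma is_derive_mode n j l t : (j < Nx)%N -> 0 <= t ->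
  is_derive_ge0 (fun s => C n s (y j l)) t (derive_ge0 (fun s => C n s (y j l)) t).
Proof.
move=> jN t0; have yj := interp_node_itv l (node_ltS mesh jN).
have [df [dfP _]] := sol_C_C1 sol n jN yj.
by rewrite (is_derive_ge0_unique t0 (dfP t t0)); exact: dfP.
Qed.

Lemma continuous_mode n j l : (j < Nx)%N ->
  continuous (fun t : R => C n (Num.max t 0) (y j l)).
Proof.
move=> jN; apply: (@is_derive_ge0_continuous _ (fun s => C n s (y j l))).
by move=> t t0; exact: is_derive_mode.
Qed.

(** The integral is a combination of the sampled values of [C n] with weights constant in time, so
    no differentiation under the integral sign is involved. *)
Lemma is_derive_cell_integral n j t (phi : R -> R) (r : {poly R}) :
  (j < Nx)%N -> 0 <= t -> (forall x, node j < x < node j.+1 -> phi x = r.[x]) ->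
  is_derive_ge0 (fun s => \int[mu]_(x in cell node j) (C n s x * phi x)) t
    (pint (node j) (node j.+1) (mode_poly_dt n t j * r)).
Proof.
move=> jN t0 phir.
have expand (u : R -> R) : pint (node j) (node j.+1) (cell_poly node k u j * r) =
    \sum_(l < k.+1) u (y j l) * pint (node j) (node j.+1) (b j l * r).
  by rewrite mulr_suml pint_sum; apply: eq_bigr => l _; rewrite -scalerAl pintZ.
rewrite expand.
apply: (@eq_is_derive_ge0 _
  (fun s => \sum_(l < k.+1) C n s (y j l) * pint (node j) (node j.+1) (b j l * r))) => //.
  move=> s s0; rewrite -expand /cell; symmetry; apply: Rintegral_eq_horner => x xj.
  by rewrite hornerM -phir// -(mode_polyE n s0 jN xj).
by apply: is_derive_ge0_lin => l; exact: is_derive_mode.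
Qed.

Lemma field_cells t : 0 <= t -> exists (q : nat -> {poly R}) (rho : R), [/\
  forall j, (j < Nx)%N -> forall x, cell node j x -> E t x = (q j).[x],
  forall j, (j < Nx)%N -> (q j)^`() = P 0%N t j - rho%:P,
  \sum_(j < Nx) pint (node j) (node j.+1) (q j) = 0 &
  \sum_(j < Nx) pint (node j) (node j.+1) (P 0%N t j) = rho * L].
Proof.
move=> t0; have [_ _ Eq] := sol_E_Wh sol t0.
have /choice[q qP] : forall j, exists p : {poly R}, (j < Nx)%N ->
    (size p <= k.+2)%N /\ forall x, cell node j x -> E t x = p.[x].
  move=> j; have [jN|jN] := ltnP j Nx; last by exists 0.
  by have [p sp pE] := Eq j jN; exists p.
have [rho [q'E q0 rhoE]] := mixed_poisson_cells mesh
  (p := P 0%N t) (fun j jN => conj (size_cell_poly k (C 0%N t) (node_ltS mesh jN))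
     (fun x xj => mode_polyE 0%N t0 jN xj)) qP (sol_poisson sol t0).
by exists q, rho; split=> // j jN; exact: (qP j jN).2.
Qed.

Lemma field_bounded t : 0 <= t ->
  exists M, forall x, 0 <= x <= L -> `|E t x| <= M.
Proof.
move=> t0; have [cE _ _] := sol_E_Wh sol t0.
have cnE : {within `[0, L], continuous (fun x => `|E t x|)}.
  move=> x; apply: (@continuous_comp (subspace `[0, L]) R R (E t)); first exact: cE.
  exact: norm_continuous.
have [c _ cP] := EVT_max (ltW L_gt0) cnE.
by exists `|E t c| => x xL; apply: cP; rewrite in_itv.
Qed.

(** By linearity the difference of two fields solves the Poisson problem for the difference of the
    densities. The [B j l] bound the basis polynomials and do not depend on time. *)
Lemma field_dist : exists B : nat -> 'I_k.+1 -> R, forall s t, 0 <= s -> 0 <= t ->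
  forall x, 0 <= x <= L -> `|E s x - E t x| <=
    4 * L * \sum_(j < Nx) \sum_(l < k.+1) `|C 0%N s (y j l) - C 0%N t (y j l)| * B j l.
Proof.
have /choice[B BP] : forall jl : nat * 'I_k.+1, exists B, 0 <= B /\
    forall x, node jl.1 <= x <= node jl.1.+1 -> `|(b jl.1 jl.2).[x]| <= B.
  move=> [j l].
  by have [B B0 BP] := horner_bounded_itv (node j) (node j.+1) (b j l); exists B.
exists (fun j l => B (j, l)) => s t s0 t0.
have [qs [rhos [qsE qs' qs0 rhosE]]] := field_cells s0.
have [qt [rhot [qtE qt' qt0 rhotE]]] := field_cells t0.
apply: (poisson_bound L_gt0 mesh (q := fun j => qs j - qt j)
  (p := fun j => P 0%N s j - P 0%N t j) (rho := rhos - rhot)).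
- by move=> j jN x xj; rewrite hornerD hornerN -qsE// -qtE.
- by move=> j jN; rewrite derivB qs'// qt'// polyCB; ring.
- by under eq_bigr do rewrite pintB; rewrite sumrB qs0 qt0 subrr.
- by under eq_bigr do rewrite pintB; rewrite sumrB rhosE rhotE mulrBl.
move=> j jN x xj; rewrite /P /mode_poly /cell_poly -sumrB horner_sum.
(* The bound has to be the same on every cell, so the nonnegative terms of the other cells are
   added. *)
rewrite (bigD1 (Ordinal jN))//= -[leLHS]addr0 lerD//; last first.
  apply: sumr_ge0 => i _; apply: sumr_ge0 => l _; rewrite mulr_ge0//.
  by have [] := BP (nat_of_ord i, l).
rewrite (le_trans (ler_norm_sum _ _ _))//; apply: ler_sum => l _.
rewrite -scalerBl hornerZ normrM ler_wpM2l//.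
by have [_ ] := BP (j, l); apply; rewrite /cell/= in_itv/= in xj.
Qed.

Let e (t : R) := supnorm L (E (Num.max t 0)).

Lemma continuous_supnorm_field : continuous e.
Proof.
have [B BP] := field_dist; move=> t.
have m0 (s : R) : 0 <= Num.max s 0 by rewrite le_max lexx orbT.
pose D (s : R) := 4 * L * \sum_(j < Nx) \sum_(l < k.+1)
  `|C 0%N (Num.max t 0) (y j l) - C 0%N (Num.max s 0) (y j l)| * B j l.
have D0 : D s @[s --> t] --> 0.
  have -> : 0 = D t.
    rewrite /D big1 ?mulr0// => j _; rewrite big1// => l _.
    by rewrite subrr normr0 mul0r.
  apply: cvgMl_tmp; apply: cvg_big => [|j _]; first exact: add_continuous.
  apply: cvg_big => [|l _]; first exact: add_continuous.
  apply: cvgMr_tmp; apply: cvg_norm; apply: cvgB; first exact: cvg_cst.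
  exact: continuous_mode.
apply/cvgrPdist_lt => eps eps0.
move/cvgrPdist_lt : D0 => /(_ eps eps0); apply: filterS => s.
rewrite sub0r normrN; apply: le_lt_trans; apply: (le_trans _ (ler_norm _)).
have [Ms MsP] := field_bounded (m0 s); have [Mt MtP] := field_bounded (m0 t).
rewrite ler_norml; apply/andP; split.
  rewrite lerBrDr addrC lerBlDr; apply: (supnorm_triangle (ltW L_gt0) MtP) => x xL.
  by rewrite distrC; exact: BP.
by rewrite lerBlDr addrC; apply: (supnorm_triangle (ltW L_gt0) MsP) => x xL; exact: BP.
Qed.

Lemma field_bounded_on T : 0 < T -> exists2 C_T, 0 < C_T &
  forall t, 0 <= t <= T -> supnorm L (E t) <= C_T.
Proof.
move=> T0; have ce : {within `[0, T], continuous e}.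
  by apply: continuous_subspaceT; exact: continuous_supnorm_field.
have [c _ cP] := EVT_max (ltW T0) ce.
exists (`|e c| + 1) => [|t tT]; first by rewrite ltr_wpDl.
have := cP t; rewrite in_itv/= => /(_ tT).
rewrite /e (max_idPl _); last by case/andP: tT.
by move=> /le_trans; apply; rewrite (le_trans (ler_norm _))// lerDl.
Qed.

(** * The scaling function *)

Let alpha := scaling L alpha0 gamma E.

Lemma scaling_gt0 t : 0 < alpha t.
Proof.
apply: mulr_gt0 => //; apply: powR_gt0; apply: ltr_wpDr => //.
apply: mulr_ge0; first by rewrite mulr_ge0 ?sqr_ge0// ltW.
by apply: Rintegral_ge0 => s _; exact: sqr_ge0.
Qed.

Lemma is_derive_scaling t : 0 <= t ->
  is_derive_ge0 alpha t (- (gamma / 2 * supnorm L (E t) ^+ 2 * alpha t ^+ 3)).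
Proof.
move=> t0; pose e2 s := e s ^+ 2.
have ce2 : continuous e2.
  by move=> s; exact: (cvgM (@continuous_supnorm_field s) (@continuous_supnorm_field s)).
have ie2 (u : R) : mu.-integrable `[-1, u] (EFin \o e2).
  by apply: continuous_integrable_itv; apply: continuous_subspaceT.
(* Integrating from [-1] makes [0] an interior point. *)
pose F (x : R) := \int[mu]_(s in `[-1, x]) e2 s.
have dF (x : R) : -1 < x -> is_derive x 1 F (e2 x).
  have xx1 : x < x + 1 by rewrite ltrDl.
  move=> x1; have [dF F'] := continuous_FTC1_closed xx1 (ie2 _) x1 (ce2 x).
  by split; [exact: dF|rewrite -derive1E; exact: F'].
have FE (s : R) : 0 <= s -> F s - F 0 = \int[mu]_(x in `[0, s]) (supnorm L (E x) ^+ 2).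
  move=> s0; rewrite /F (@Rintegral_itvB _ e2 (BLeft (-1)))//.
  - rewrite Rintegral_itv_obnd_cbnd; last first.
      apply: integrableS (ie2 s) => // x /=; rewrite !in_itv/= => /andP[x0 ->].
      by rewrite andbT; lra.
    apply: eq_Rintegral => x; rewrite inE/= in_itv/= => /andP[x0 _].
    by rewrite /e2 /e (max_idPl x0).
  - by rewrite bnd_simp.
pose u (x : R) := 1 + gamma * alpha0 ^+ 2 * (F x - F 0).
have uE (s : R) : 0 <= s -> alpha s = alpha0 * u s `^ (- 2^-1).
  by move=> s0; rewrite /alpha /scaling /u FE.
apply: (@eq_is_derive_ge0 _ (fun s => alpha0 * u s `^ (- 2^-1))) => //.
  by move=> s s0; rewrite uE.
apply: is_derive_is_derive_ge0.
have u_gt0 : 0 < u t.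
  rewrite /u FE// ltr_wpDr// mulr_ge0//; first by rewrite mulr_ge0 ?sqr_ge0// ltW.
  by apply: Rintegral_ge0 => s _; exact: sqr_ge0.
have du : is_derive t 1 u (gamma * alpha0 ^+ 2 * e2 t).
  have := dF t (lt_le_trans (ltrN10 R) t0) => dFt.
  by apply: trigger_derive; rewrite /GRing.scale/=; ring.
have dp := is_derive1_comp (is_derive1_powR (- 2^-1) u_gt0) du.
apply: trigger_derive; rewrite /GRing.scale/= uE// /e2 /e (max_idPl t0).
(* The power -3/2 is the cube of the power -1/2; with the prefactor [alpha0] and the [alpha0 ^+ 2]
   inside [u], it makes up alpha^3. *)
have -> : - 2^-1 - 1 = - 2^-1 * 3%:R :> R by field.
by rewrite powRrM powR_mulrn ?powR_ge0//; field.
Qed.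

(** * The scheme in terms of cell polynomials *)

Let Pt (t : R) (n j : nat) : {poly R} := P n t j.
Let de (t : R) (n : nat) : R := delta NH alpha n t.

Lemma lag_delay d n t j x : 0 <= t -> (j < Nx)%N -> node j < x < node j.+1 ->
  lag C d n t x = (delay (fun m => Pt t m j) d n).[x].
Proof.
move=> t0 jN xj; rewrite /lag /delay; case: ifP => _; last by rewrite horner0.
exact: mode_polyE.
Qed.

Lemma gfun_gpoly n t j x : 0 <= t -> (j < Nx)%N -> node j < x < node j.+1 ->
  gfun alpha C n t x = (gpoly (alpha t) (Pt t) n j).[x].
Proof.
move=> t0 jN xj; rewrite /gfun /gpoly hornerZ hornerD !hornerZ; congr (_ * (_ + _)).
  by rewrite (mode_polyE n.+1 t0 jN xj).
case: n => [|n]; first by rewrite sqrtr0 !mul0r.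
by rewrite (lag_delay _ _ t0 jN xj) /delay subn1.
Qed.

Lemma num_flux_upwind n t i : 0 <= t -> (i <= Nx)%N ->
  num_flux Nx node NH alpha C n t i = upwind_flux Nx node (alpha t) (de t) (Pt t) n i.
Proof.
move=> t0 iN; rewrite /num_flux /upwind_flux.
have g := fun j jN x xj => @gfun_gpoly n t j x t0 jN xj.
have c := fun j jN x xj => @mode_polyE n t j x t0 jN xj.
rewrite (traceL_trL L_gt0 mesh g)// (traceR_trR L_gt0 mesh g)//.
by rewrite (traceL_trL L_gt0 mesh c)// (traceR_trR L_gt0 mesh c).
Qed.

Lemma aform_cell_form n j t : 0 <= t -> (j < Nx)%N ->
  aform Nx node NH alpha C n j t (C n t) = cell_form Nx node (alpha t) (de t) (Pt t) n j.
Proof.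
move=> t0 jN; rewrite /aform /cell_form.
have c := fun j jN x xj => @mode_polyE n t j x t0 jN xj.
rewrite !num_flux_upwind ?(ltnW jN)//.
rewrite (traceL_trL L_gt0 mesh c)// (traceR_trR L_gt0 mesh c) ?(ltnW jN)//.
rewrite /trL /trR /= (ltn_eqF jN); congr (- _ + _ - _).
apply: Rintegral_eq_horner => x xj.
by rewrite hornerM (gfun_gpoly _ t0 jN xj) (derive1_eq_horner (c j jN)).
Qed.

(** The test function is [C n] frozen at time [t], so the time derivative falls on one factor only
    and produces half the derivative of the squared mode. *)
Lemma energy_identity n j t (q : {poly R}) : 0 <= t -> (j < Nx)%N -> (n < NH)%N ->
  (forall x, cell node j x -> E t x = q.[x]) ->
  pint (node j) (node j.+1) (mode_poly_dt n t j * Pt t n j) =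
  - (gamma / 2 * supnorm L (E t) ^+ 2 * alpha t ^+ 2) *
    (n%:R * pint (node j) (node j.+1) (Pt t n j ^+ 2) +
     Num.sqrt (n.-1 * n)%:R *
       pint (node j) (node j.+1) (delay (fun m => Pt t m j) 2 n * Pt t n j))
  - cell_form Nx node (alpha t) (de t) (Pt t) n j
  + alpha t * Num.sqrt n%:R *
    pint (node j) (node j.+1) (q * delay (fun m => Pt t m j) 1 n * Pt t n j).
Proof.
move=> t0 jN nN Eq.
have c := fun x xj => @mode_polyE n t j x t0 jN xj.
have scheme := sol_vlasov sol (sol_C_Vh sol n t0) jN nN t0.
rewrite (is_derive_ge0_unique t0 (is_derive_cell_integral (n := n) jN t0 c)) in scheme.
rewrite (is_derive_ge0_unique t0 (is_derive_scaling t0)) aform_cell_form// in scheme.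
rewrite (@Rintegral_eq_horner _ _ _ _ ((n%:R *: Pt t n j +
   Num.sqrt (n.-1 * n)%:R *: delay (fun m => Pt t m j) 2 n) * Pt t n j)) in scheme; last first.
  by move=> x xj; rewrite (lag_delay _ _ t0 jN xj) c// !(hornerM, hornerD, hornerZ).
rewrite (@Rintegral_eq_horner _ _ _ _ (q * delay (fun m => Pt t m j) 1 n * Pt t n j))
  in scheme; last first.
  move=> x xj; rewrite (lag_delay _ _ t0 jN xj) c// !hornerM Eq//.
  by case/andP: xj => jx xj; rewrite /cell/= in_itv/= (ltW jx) (ltW xj).
have pint_lin (c1 c2 : R) (u v w : {poly R}) :
    pint (node j) (node j.+1) ((c1 *: u + c2 *: v) * w) =
    c1 * pint (node j) (node j.+1) (u * w) + c2 * pint (node j) (node j.+1) (v * w).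
  by rewrite mulrDl pintD -!scalerAl !pintZ.
rewrite pint_lin -expr2 -/alpha in scheme.
have al0 : alpha t != 0 by rewrite gt_eqF// scaling_gt0.
have -> : - (gamma / 2 * supnorm L (E t) ^+ 2 * alpha t ^+ 2) =
    - (gamma / 2 * supnorm L (E t) ^+ 2 * alpha t ^+ 3) / alpha t by field.
by apply/eqP; rewrite -subr_eq0 -scheme; apply/eqP; ring.
Qed.

(** * Growth of the energy *)

Let W (t : R) : R := \sum_(j < Nx) \sum_(n < NH) pint (node j) (node j.+1) (P n t j ^+ 2).
Let dW (t : R) : R := \sum_(j < Nx) \sum_(n < NH)
   pint (node j) (node j.+1) (mode_poly_dt n t j * P n t j) *+ 2.

(** The right side minus the left side is the integral over the cells of the sum of the moment
    terms, plus 2 alpha times the flux forms; both parts are nonnegative. *)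
Lemma energy_decay t : 0 <= t ->
  - (gamma / 2 * supnorm L (E t) ^+ 2 * alpha t ^+ 3) * W t + alpha t * dW t <=
  (2 * gamma)^-1 * (alpha t * W t).
Proof.
move=> t0; have [q [_ [qE _ _ _]]] := field_cells t0.
have al0 := scaling_gt0 t.
set en := supnorm L (E t); set a := gamma / 2 * en ^+ 2 * alpha t ^+ 3.
pose d := alpha t / (2 * gamma).
have a0 : 0 <= a.
  apply: mulr_ge0; last by rewrite exprn_ge0// ltW.
  by apply: mulr_ge0; [rewrite divr_ge0// ltW|exact: sqr_ge0].
have d0 : 0 <= d by apply: divr_ge0; [exact: ltW|rewrite mulr_ge0// ltW].
pose I j := pint (node j) (node j.+1).
pose T (n j : nat) : R := a * (n.*2.+1%:R * I j (Pt t n j ^+ 2) + 2 *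
  (Num.sqrt (n.-1 * n)%:R * I j (delay (fun m => Pt t m j) 2 n * Pt t n j)))
  + d * I j (Pt t n j ^+ 2) - 2 * alpha t ^+ 2 * (Num.sqrt n%:R *
    I j (q j * delay (fun m => Pt t m j) 1 n * Pt t n j)).
have T0 j : (j < Nx)%N -> 0 <= \sum_(n < NH) T n j.
  (* The values of these polynomials are moment terms with the local field q(x) in the coefficient
     [b]; positivity is proved at each x, where |q(x)| <= |E|_oo, and then integrated. *)
  move=> jN; pose tp n : {poly R} := a *: (n.*2.+1%:R *: Pt t n j ^+ 2 + 2 *:
    (Num.sqrt (n.-1 * n)%:R *: (delay (fun m => Pt t m j) 2 n * Pt t n j)))
    + d *: (Pt t n j ^+ 2) - (2 * alpha t ^+ 2) *: (Num.sqrt n%:R *: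
    (q j * delay (fun m => Pt t m j) 1 n * Pt t n j)).
  rewrite (_ : \sum_(n < NH) _ = I j (\sum_(n < NH) tp n)); last first.
    rewrite /I pint_sum; apply: eq_bigr => n _.
    by rewrite /tp pintB !pintD !pintZ pintD !pintZ.
  apply: pint_ge0 => x xj; rewrite horner_sum.
  have delayE m n : (delay (fun m => Pt t m j) m n).[x] = delay (fun m => (Pt t m j).[x]) m n.
    by rewrite /delay; case: ifP => _; rewrite ?horner0.
  rewrite (eq_bigr (fun n : 'I_NH => moment_term (fun m => (Pt t m j).[x]) a
     (alpha t ^+ 2 * (q j).[x]) d n)); last first.
    move=> n _; rewrite /tp /moment_term -!delayE.
    rewrite !(hornerM, hornerD, hornerZ, hornerN, horner_exp); ring.
  apply: moment_form_ge0 => //.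
  have qe : (q j).[x] ^+ 2 <= en ^+ 2.
    have [M MP] := field_bounded t0.
    have xL : 0 <= x <= L.
      have [node0 nodeN _] := mesh; case/andP: xj => jx xj.
      rewrite -{1}node0 -nodeN (le_trans (node_le mesh (leq0n j) (ltnW jN)))//=.
      by rewrite (le_trans xj)// (node_le mesh).
    rewrite -qE//.
    have le_en := le_supnorm MP xL; have en0 := le_trans (normr_ge0 _) le_en.
    by rewrite -(real_normK (num_real (E t x))) ler_pXn2r ?nnegrE.
  rewrite (_ : 4 * a * d = (alpha t ^+ 2) ^+ 2 * en ^+ 2).
    by rewrite exprMn ler_wpM2l// sqr_ge0.
  by rewrite /a /d; field; rewrite gt_eqF.
have D0 : 0 <= \sum_(n < NH) \sum_(j < Nx) cell_form Nx node (alpha t) (de t) (Pt t) n j.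
  apply: (sum_cell_form_ge0 (alpha t) (node_ltS mesh)) => [n|j].
    by rewrite /de /delta; case: ifP => // _; rewrite divr_ge0 ?sqrtr_ge0 ?(ltW al0).
  by apply: cell_poly_eq0 => x; rewrite (sol_C_trunc sol x (leqnn NH) t0).
rewrite exchange_big/= in D0; rewrite -subr_ge0.
rewrite (_ : _ - _ = \sum_(j < Nx) (\sum_(n < NH) T n j + 2 * alpha t *
   \sum_(n < NH) cell_form Nx node (alpha t) (de t) (Pt t) n j)).
  rewrite big_split/= addr_ge0//; first by apply: sumr_ge0 => j _; exact: T0.
  by rewrite -mulr_sumr mulr_ge0// mulr_ge0// ltW.
rewrite mulNr opprD opprK /W /dW !mulr_sumr -sumrN -!big_split/=.
apply: eq_bigr => j _; rewrite !mulr_sumr -sumrN -!big_split/=.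
apply: eq_bigr => n _; rewrite (energy_identity t0 _ _ (qE j _))//.
rewrite /T -/(Pt t n j) -/(I j) /a /d -/en.
rewrite (_ : n.*2.+1%:R = 2 * n%:R + 1 :> R); last by rewrite -addn1 natrD -mul2n natrM.
by field; rewrite gt_eqF.
Qed.

Lemma cell_energyE n j t : pint (node j) (node j.+1) (P n t j ^+ 2) =
  \sum_(l < k.+1) \sum_(m < k.+1) C n t (y j l) * C n t (y j m) *
    pint (node j) (node j.+1) (b j l * b j m).
Proof.
rewrite expr2 mulr_suml pint_sum; apply: eq_bigr => l _.
rewrite mulr_sumr pint_sum; apply: eq_bigr => m _.
by rewrite -scalerAl -scalerAr !pintZ mulrA.
Qed.

Lemma continuous_energy : continuous (fun t : R => W (Num.max t 0)).
Proof.
move=> t; apply: cvg_big => [|j _]; first exact: add_continuous.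
apply: cvg_big => [|n _]; first exact: add_continuous.
under eq_fun do rewrite cell_energyE.
rewrite cell_energyE.
apply: cvg_big => [|l _]; first exact: add_continuous.
apply: cvg_big => [|m _]; first exact: add_continuous.
by apply: cvgMr_tmp; apply: cvgM; exact: continuous_mode.
Qed.

Lemma is_derive_energy (t : R) : 0 < t -> is_derive t 1 W (dW t).
Proof.
move=> t0.
rewrite (_ : W = \sum_(j < Nx) \sum_(n < NH)
    (fun s => pint (node j) (node j.+1) (P n s j ^+ 2))); last first.
  by apply/funext => s; rewrite fct_sumE; apply: eq_bigr => j _; rewrite fct_sumE.
apply: is_derive_sum => j; apply: is_derive_sum => n.
rewrite (_ : (fun s => _) = fun s => \sum_(l < k.+1) \sum_(m < k.+1)
    C n s (y j l) * C n s (y j m) * pint (node j) (node j.+1) (b j l * b j m)); last first.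
  by apply/funext => s; rewrite cell_energyE.
have dC l := is_derive_ge0_is_derive t0
  (is_derive_mode (n := n) (l := l) (ltn_ord j) (ltW t0)).
apply: trigger_derive; first exact: (is_derive_quadratic _ dC).
pose g l m := pint (node j) (node j.+1) (b j l * b j m).
pose c' l := derive_ge0 (fun s => C n s (y j l)) t.
rewrite (_ : pint _ _ _ = \sum_(l < k.+1) \sum_(m < k.+1) c' l * C n t (y j m) * g l m).
  under eq_bigr do (under eq_bigr do rewrite mulrDl; rewrite big_split/=).
  rewrite big_split/= mulr2n; congr (_ + _).
  rewrite exchange_big/=; apply: eq_bigr => l _; apply: eq_bigr => m _.
  by rewrite /g [b j m * _]mulrC [C _ _ _ * _]mulrC.
rewrite mulr_suml pint_sum; apply: eq_bigr => l _.
rewrite mulr_sumr pint_sum; apply: eq_bigr => m _.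
by rewrite -scalerAl -scalerAr !pintZ mulrA.
Qed.

(** The energy times the integrating factor exp(-t/(2 gamma)) has nonpositive derivative for t > 0
    and is continuous up to 0, hence nonincreasing on [0, +oo[. *)
Lemma energy_growth t : 0 <= t ->
  alpha t * W t <= alpha 0 * W 0 * expR (t / (2 * gamma)).
Proof.
move=> t0; pose G (s : R) := alpha s * W s * expR (- (s / (2 * gamma))).
have alD (s : R) : 0 < s -> is_derive s 1 alpha
    (- (gamma / 2 * supnorm L (E s) ^+ 2 * alpha s ^+ 3)).
  move=> s0; apply: is_derive_ge0_is_derive => //.
  by apply: is_derive_scaling; exact: ltW.
have GD (s : R) : 0 < s -> is_derive s 1 G
   ((- (gamma / 2 * supnorm L (E s) ^+ 2 * alpha s ^+ 3) * W s + alpha s * dW s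
     - (2 * gamma)^-1 * (alpha s * W s)) * expR (- (s / (2 * gamma)))).
  move=> s0; have := alD s s0; have := is_derive_energy s0 => dWs dal.
  apply: trigger_derive; rewrite /GRing.scale/=; field; rewrite gt_eqF//.
have cG : continuous (fun s : R => G (Num.max s 0)).
  move=> s; apply: cvgM; last first.
    apply: (@is_derive_ge0_continuous _ (fun r => expR (- (r / (2 * gamma))))
      (fun r => - (2 * gamma)^-1 * expR (- (r / (2 * gamma))))) => r _.
    apply: is_derive_is_derive_ge0; apply: trigger_derive.
    by rewrite /GRing.scale/=; field; rewrite gt_eqF.
  apply: cvgM; last exact: continuous_energy.
  by apply: (@is_derive_ge0_continuous _ alpha); exact: is_derive_scaling.
have cG0 : {within `[0, +oo[, continuous G}.
  apply: (@subspace_eq_continuous _ _ _ (fun s : R => G (Num.max s 0))).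
    by move=> s; rewrite inE/= in_itv/= andbT => s0; rewrite (max_idPl s0).
  exact: continuous_subspaceT.
have := ler0_derive1_nincry _ _ cG0 (lexx 0) t0.
rewrite /G mul0r oppr0 expR0 mulr1 expRN ler_pdivrMr ?expR_gt0//; apply.
- by move=> s; rewrite in_itv/= andbT => /GD[].
- move=> s; rewrite in_itv/= andbT => s0; rewrite derive1E.
  have [_ ->] := GD s s0; rewrite pmulr_lle0 ?expR_gt0// subr_le0.
  exact: energy_decay (ltW s0).
Qed.

Lemma weighted_norm_growth t : 0 <= t ->
  (weighted_norm L (weight alpha t) (f_approx NH alpha C t) <=
   weighted_norm L (weight alpha 0%R) (f_approx NH alpha C 0%R) *
   (expR (t / (4 * gamma))%R)%:E)%E.
Proof.
move=> t0; have norm s : 0 <= s ->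
    weighted_norm L (weight alpha s) (f_approx NH alpha C s) =
    (Num.sqrt (alpha s * W s))%:E.
  move=> s0; apply: (weighted_norm_hermite NH mesh (scaling_gt0 s) (P := Pt s)).
  by move=> n j jN x xj; exact: mode_polyE.
(* Rewriting with [norm] directly makes unification unfold the scaling function. *)
have le_eq (u v u' v' c : \bar R) :
  u = u' -> v = v' -> (u' <= v' * c -> u <= v * c)%E by move=> -> ->.
apply: (le_eq _ _ _ _ _ (norm t t0) (norm 0 (lexx 0))); rewrite -EFinM lee_fin.
(* The norm is the square root of the energy, which halves the exponential rate. *)
rewrite (_ : expR _ = Num.sqrt (expR (t / (2 * gamma)))); last first.
  rewrite (_ : t / (2 * gamma) = t / (4 * gamma) *+ 2); last first.
    by rewrite -mulr_natr; field; rewrite gt_eqF.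
  by rewrite mulr2n expRD -expr2 sqrtr_sqr ger0_norm// expR_ge0.
have W0 : 0 <= alpha 0 * W 0.
  rewrite mulr_ge0 ?(ltW (scaling_gt0 _))//.
  apply: sumr_ge0 => j _; apply: sumr_ge0 => n _; apply: pint_ge0 => x _.
  by rewrite horner_exp sqr_ge0.
by rewrite -sqrtrM// ler_sqrt ?energy_growth// mulr_ge0// expR_ge0.
Qed.

(** * Conservation of mass *)

Lemma mass_conservation t : (0 < NH)%N -> 0 <= t ->
  is_derive_ge0 (fun s => \int[mu]_(x in `[0, L]) C 0%N s x) t 0.
Proof.
move=> NH0 t0; have one j x :
    node j < x < node j.+1 -> (fun=> 1) x = (1 : {poly R}).[x].
  by rewrite -polyC1 hornerC.
have cellD j (jN : (j < Nx)%N) := is_derive_cell_integral (n := 0%N) jN t0 (one j).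
have tL i : (i <= Nx)%N -> traceL Nx node (fun=> 1) i = 1.
  move=> iN; rewrite (traceL_trL L_gt0 mesh (fun j _ => one j) iN) /trL.
  by case: ifP => _; rewrite -polyC1 hornerC.
have tR i : (i <= Nx)%N -> traceR Nx node (fun=> 1) i = 1.
  move=> iN; rewrite (traceR_trR L_gt0 mesh (fun j _ => one j) iN) /trR.
  by case: ifP => _; rewrite -polyC1 hornerC.
have oneV : Vh Nx node k (fun=> 1).
  by move=> j jN; exists 1; [rewrite size_poly1|exact: one].
apply: (@eq_is_derive_ge0 _ (fun s => \sum_(j < Nx)
   \int[mu]_(x in cell node j) (C 0%N s x * 1))) => //.
  move=> s s0; have [node0 nodeN _] := mesh.
  have [_ _] := piecewise_horner_integral (node_ltS mesh)
    (fun j jN x xj => @mode_polyE 0%N s j x s0 jN xj).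
  rewrite node0 nodeN => ->; apply: eq_bigr => j _; apply: Rintegral_eq_horner => x xj.
  by rewrite mulr1 (mode_polyE 0%N s0 (ltn_ord j) xj).
have fluxE : \sum_(j < Nx) pint (node j) (node j.+1) (mode_poly_dt 0%N t j * 1) = 0.
  pose fl := num_flux Nx node NH alpha C 0%N t.
  rewrite (eq_bigr (fun j : 'I_Nx => - (fl j.+1 - fl j))); last first.
    move=> j _; have := sol_vlasov sol oneV (ltn_ord j) NH0 t0.
    rewrite (is_derive_ge0_unique t0 (cellD j (ltn_ord j))) /aform.
    rewrite tL// (tR _ (ltnW (ltn_ord j))).
    (* For n = 0 the scaling and field integrands vanish identically, and so does the volume term
       since the test function 1 has zero derivative; only the two fluxes remain. *)
    have zero (h : R -> R) : (forall x, h x = 0) -> \int[mu]_(x in cell node j) h x = 0.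
      move=> h0; rewrite /cell (@Rintegral_eq_horner _ _ _ _ 0) ?pint0// => x _.
      by rewrite h0 horner0.
    rewrite (zero (fun x => gfun _ C 0%N t x * derive1 (fun _ : R => 1 : R) x)); last first.
      by move=> x; rewrite derive1_cst mulr0.
    rewrite (zero (fun x => (0%:R * C 0%N t x + _ * lag C 2 0%N t x) * 1)); last first.
      by move=> x; rewrite /lag/= mulr0 mul0r addr0 mul0r.
    rewrite (zero (fun x => E t x * lag C 1 0%N t x * 1)); last first.
      by move=> x; rewrite /lag/= mulr0 mul0r.
    by rewrite -/fl sqrtr0; lra.
  rewrite sumrN -(big_mkord xpredT (fun j => fl j.+1 - fl j)) telescope_sumr//.
  (* The remaining end fluxes, at 0 and at L, coincide because the traces there are identified. *)
  rewrite /fl !num_flux_upwind// /upwind_flux.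
  by rewrite !trL_periodic !trR_periodic subrr oppr0.
rewrite -[X in is_derive_ge0 _ _ X]fluxE.
by apply: is_derive_ge0_sum => j; exact: cellD.
Qed.

End solution.

Theorem theorem3p6 (R : realType) (L alpha0 gamma : R)
    (L_gt0 : 0 < L) (alpha0_gt0 : 0 < alpha0) (gamma_gt0 : 0 < gamma)
    (Nx : nat) (node : nat -> R) (mesh : is_partition L Nx node)
    (NH k : nat) (NH_ge3 : (3 <= NH)%N)
    (C : nat -> R -> R -> R) (E Phi : R -> R -> R)
    (sol : dg_hermite_solution L alpha0 gamma Nx node NH k C E Phi) :
  let alpha := scaling L alpha0 gamma E in
  let f := f_approx NH alpha C in
  [/\ forall t : R, 0 <= t ->
        is_derive_ge0
          (fun s : R => \int[@lebesgue_measure R]_(x in `[0, L]) (C 0%N s x)) t 0,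
      (weighted_norm L (weight alpha 0%R) (f 0%R) < +oo)%E ->
        forall t : R, 0 <= t ->
        (weighted_norm L (weight alpha t) (f t) <=
         weighted_norm L (weight alpha 0%R) (f 0%R) *
         (expR (t / (4 * gamma))%R)%:E)%E
    & forall T : R, 0 < T -> exists2 C_T : R, 0 < C_T &
        forall t : R, 0 <= t <= T -> supnorm L (E t) <= C_T].
Proof.
move=> alpha f; split.
- move=> t t0; apply: (mass_conservation L_gt0 mesh sol _ t0).
  exact: ltnW (ltnW NH_ge3).
- move=> _ t t0.
  exact: (weighted_norm_growth L_gt0 alpha0_gt0 gamma_gt0 mesh sol t0).
- by move=> T; exact: (field_bounded_on L_gt0 mesh sol).
Qed.
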